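(* Let $G$ be a group and let $X$ be a cocompact generalized Baumslag--Solitar tree with group $G$. Then $X$ is related by a deformation to a fully reduced generalized Baumslag--Solitar tree with group $G$.
   Context: A $G$-tree is a simplicial tree with an action of $G$ by automorphisms, without inversions; $G_x$ denotes the stabilizer of a vertex or edge $x$, and an oriented edge $e$ has initial vertex $\partial_0 e$ and terminal vertex $\partial_1 e$. $G$-trees are considered up to $G$-equivariant isomorphism. A $G$-tree is cocompact if its quotient graph is finite. A generalized Baumslag--Solitar tree (with group $G$) is a $G$-tree all of whose vertex and edge stabilizers are infinite cyclic. Collapse move: in a graph of groups, an edge carrying an amalgamation of the form $A *_C C$ (a non-loop edge whose edge group $C$ maps isomorphically onto the vertex group at one end) is collapsed to a vertex with group $A$; every inclusion map with target the vertex group $C$ is reinterpreted as a map into $A$ via $C \hookrightarrow A$. On the $G$-tree: if $e$ is an edge with $G_e = G_{\partial_1 e}$ and $\partial_0 e,\partial_1 e$ in different $G$-orbits, every edge in the orbit of $e$ is collapsed to a vertex. An expansion move is the reverse of a collapse move. Collapse and expansion moves are called elementary moves. A deformation is a finite sequence of elementary moves. A $G$-tree is fully reduced if no vertex stabilizer contains the stabilizer of a vertex from a different $G$-orbit; equivalently, in the quotient graph of groups no vertex group can be conjugated into the vertex group of another vertex. *)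

(* Defs.v *)
From Stdlib Require Import Relations.
From mathcomp Require Import all_boot.
From mathcomp Require Import boolp classical_sets functions cardinality.

Set Implicit Arguments.
Unset Strict Implicit.
Unset Printing Implicit Defensive.

Local Open Scope classical_set_scope.

(* Graphs are taken in the sense of Serre: every geometric edge is a pair
   {e, bar e} of distinct oriented edges. *)
Record Ggraph (G : groupType) := MkGgraph {
  vertex : Type;
  edge : Type;
  d0 : edge -> vertex;
  d1 : edge -> vertex;
  bar : edge -> edge;
  actV : G -> vertex -> vertex;
  actE : G -> edge -> edge;
  barK : forall e, bar (bar e) = e;
  bar_neq : forall e, bar e <> e;
  d0_bar : forall e, d0 (bar e) = d1 e;
  actV1 : forall v, actV 1%g v = v;
  actVM : forall g h v, actV (g * h)%g v = actV g (actV h v);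
  actE1 : forall e, actE 1%g e = e;
  actEM : forall g h e, actE (g * h)%g e = actE g (actE h e);
  d0_act : forall g e, d0 (actE g e) = actV g (d0 e);
  d1_act : forall g e, d1 (actE g e) = actV g (d1 e);
  bar_act : forall g e, bar (actE g e) = actE g (bar e);
  no_inversion : forall g e, actE g e <> bar e
}.

Section Graph.
Variables (G : groupType) (X : Ggraph G).
Implicit Types (u v : vertex X) (e f : edge X) (p : seq (edge X)).

Fixpoint is_path u p v : Prop :=
  match p with
  | [::] => u = v
  | e :: p' => d0 e = u /\ is_path (d1 e) p' v
  end.

Fixpoint reduced p : Prop :=
  match p with
  | e :: ((f :: _) as p') => f <> bar e /\ reduced p'
  | _ => True
  end.

Definition is_tree : Prop :=
  [/\ exists v : vertex X, True,
      forall u v, exists p, is_path u p v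
    & forall v p, is_path v p v -> reduced p -> p = [::]].

Definition stabV v : set G := [set g | actV g v = v].
Definition stabE e : set G := [set g | actE g e = e].

Definition orbitV v : set (vertex X) := [set actV g v | g in [set: G]].
Definition orbitE e : set (edge X) := [set actE g e | g in [set: G]].

(* The vertices (oriented edges) of the quotient graph are the orbits of
   vertices (oriented edges). *)
Definition cocompact : Prop :=
  finite_set (range orbitV) /\ finite_set (range orbitE).

Definition fully_reduced : Prop :=
  forall u v, stabV u `<=` stabV v -> orbitV u = orbitV v.

End Graph.

Record Gtree (G : groupType) := MkGtree {
  Gtree_graph :> Ggraph G;
  Gtree_is_tree : is_tree Gtree_graph
}.

Definition infinite_cyclic (G : groupType) (H : set G) : Prop :=
  infinite_set H /\
  exists g : G, H = [set x | exists n : nat, x = (g ^+ n)%g \/ x = (g ^- n)%g].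

Definition is_GBS (G : groupType) (X : Gtree G) : Prop :=
  (forall v : vertex X, infinite_cyclic (stabV v)) /\
  (forall e : edge X, infinite_cyclic (stabE e)).

Record Giso (G : groupType) (X Y : Ggraph G) := MkGiso {
  isoV : vertex X -> vertex Y;
  isoE : edge X -> edge Y;
  isoV_bij : bijective isoV;
  isoE_bij : bijective isoE;
  iso_d0 : forall e, d0 (isoE e) = isoV (d0 e);
  iso_d1 : forall e, d1 (isoE e) = isoV (d1 e);
  iso_bar : forall e, bar (isoE e) = isoE (bar e);
  iso_actV : forall g v, actV g (isoV v) = isoV (actV g v);
  iso_actE : forall g e, actE g (isoE e) = isoE (actE g e)
}.

Definition isomorphic (G : groupType) (X Y : Ggraph G) : Prop :=
  inhabited (Giso X Y).

Section Collapse.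
Variables (G : groupType) (X : Ggraph G) (e : edge X).

(* A geometric edge is collapsed together with both of its orientations. *)
Definition collapsed (f : edge X) : Prop := orbitE e f \/ orbitE e (bar f).

Definition joined (u v : vertex X) : Prop :=
  exists f, [/\ collapsed f, d0 f = u & d1 f = v].

Definition cclass (v : vertex X) : set (vertex X) :=
  [set u | clos_refl_sym_trans _ joined v u].

Definition cvertex : Type := {C : set (vertex X) | exists v, C = cclass v}.
Definition cedge : Type := {f : edge X | ~ collapsed f}.

Definition cproj (v : vertex X) : cvertex :=
  exist _ (cclass v) (ex_intro _ v erefl).

Lemma orbitE_act (f f' : edge X) (g : G) :
  orbitE f (actE g f') <-> orbitE f f'.
Proof.
split=> -[h _ hE].
  by exists (g^-1 * h)%g => //; rewrite actEM hE -actEM mulVg actE1.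
by exists (g * h)%g => //; rewrite actEM hE.
Qed.

Lemma collapsed_act g f : collapsed (actE g f) <-> collapsed f.
Proof. by rewrite /collapsed bar_act !orbitE_act. Qed.

Lemma collapsed_bar f : collapsed (bar f) <-> collapsed f.
Proof. by rewrite /collapsed barK; split=> -[]; [right|left|right|left]. Qed.

Lemma cclass_act g u v : cclass u v -> cclass (actV g u) (actV g v).
Proof.
elim=> [{}u {}v [f [fe <- <-]]|w|{}u {}v _ IH|{}u w {}v _ IH1 _ IH2].
- apply: rst_step; exists (actE g f).
  by split; [apply/collapsed_act | rewrite d0_act | rewrite d1_act].
- exact: rst_refl.
- exact: rst_sym.
- exact: rst_trans IH1 IH2.
Qed.

Lemma cclass_image g v : actV g @` cclass v = cclass (actV g v).
Proof.
apply/seteqP; split=> [_ [u uv <-]|u uv]; first exact: cclass_act.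
exists (actV g^-1%g u); last by rewrite -actVM mulgV actV1.
have := cclass_act g^-1%g uv.
by rewrite -actVM mulVg actV1.
Qed.

Lemma cactV_subproof g (C : cvertex) :
  exists v, actV g @` sval C = cclass v.
Proof. by have [v ->] := svalP C; exists (actV g v); rewrite cclass_image. Qed.

Definition cactV g (C : cvertex) : cvertex :=
  exist _ (actV g @` sval C) (cactV_subproof g C).

Lemma cactE_subproof g (f : cedge) : ~ collapsed (actE g (sval f)).
Proof. by move=> /collapsed_act; apply: svalP f. Qed.

Definition cactE g (f : cedge) : cedge :=
  exist _ (actE g (sval f)) (@cactE_subproof g f).

Lemma cbar_subproof (f : cedge) : ~ collapsed (bar (sval f)).
Proof. by move=> /collapsed_bar; apply: svalP f. Qed.

Definition cbar (f : cedge) : cedge :=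
  exist _ (bar (sval f)) (@cbar_subproof f).

Definition cd0 (f : cedge) : cvertex := cproj (d0 (sval f)).
Definition cd1 (f : cedge) : cvertex := cproj (d1 (sval f)).

Lemma sval_inj (T : Type) (P : T -> Prop) (x y : {z | P z}) :
  sval x = sval y -> x = y.
Proof. by case: x y => [x px] [y py] /= xy; apply: eq_exist. Qed.

Lemma cbarK f : cbar (cbar f) = f.
Proof. by apply: sval_inj; rewrite /= barK. Qed.
Lemma cbar_neq f : cbar f <> f.
Proof. by move=> /(congr1 sval)/= /bar_neq. Qed.
Lemma cd0_bar f : cd0 (cbar f) = cd1 f.
Proof. by apply: sval_inj; rewrite /= d0_bar. Qed.
Lemma cactV1 C : cactV 1%g C = C.
Proof.
apply: sval_inj => /=.
by rewrite (_ : actV 1%g = id) ?image_id //; apply/funext => v; rewrite actV1.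
Qed.
Lemma cactVM g h C : cactV (g * h)%g C = cactV g (cactV h C).
Proof.
apply: sval_inj; rewrite /= image_comp.
by congr image; apply/funext => v; rewrite /= actVM.
Qed.
Lemma cactE1 f : cactE 1%g f = f.
Proof. by apply: sval_inj; rewrite /= actE1. Qed.
Lemma cactEM g h f : cactE (g * h)%g f = cactE g (cactE h f).
Proof. by apply: sval_inj; rewrite /= actEM. Qed.
Lemma cd0_act g f : cd0 (cactE g f) = cactV g (cd0 f).
Proof. by apply: sval_inj; rewrite /= d0_act cclass_image. Qed.
Lemma cd1_act g f : cd1 (cactE g f) = cactV g (cd1 f).
Proof. by apply: sval_inj; rewrite /= d1_act cclass_image. Qed.
Lemma cbar_act g f : cbar (cactE g f) = cactE g (cbar f).
Proof. by apply: sval_inj; rewrite /= bar_act. Qed.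
Lemma cno_inversion g f : cactE g f <> cbar f.
Proof. by move=> /(congr1 sval)/= /no_inversion. Qed.

Definition collapse : Ggraph G :=
  MkGgraph cbarK cbar_neq cd0_bar cactV1 cactVM cactE1 cactEM
    cd0_act cd1_act cbar_act cno_inversion.

End Collapse.

Definition collapse_move (G : groupType) (X Y : Gtree G) : Prop :=
  exists e : edge X,
    [/\ stabE e = stabV (d1 e), orbitV (d0 e) <> orbitV (d1 e)
      & isomorphic (collapse e) Y].

Definition elementary_move (G : groupType) (X Y : Gtree G) : Prop :=
  collapse_move X Y \/ collapse_move Y X.

(* Trees are considered up to isomorphism, so the empty sequence of moves
   relates isomorphic trees. *)
Inductive deformation (G : groupType) : Gtree G -> Gtree G -> Prop :=
| deformation_iso (X Y : Gtree G) : isomorphic X Y -> deformation X Y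
| deformation_step (X Y Z : Gtree G) :
    elementary_move X Y -> deformation Y Z -> deformation X Z.

(* Main.v *)
From mathcomp Require Import all_boot.
From mathcomp Require Import boolp classical_sets functions cardinality.
From Stdlib Require Import Relations.
From Stdlib Require List.
Require Import Defs.

(** The proof is by induction on the number of edge orbits.  A collapse move
    lowers that number, so it is enough to find, in a tree that is not fully
    reduced, a deformation that keeps the number of edge orbits and creates an
    edge that can be collapsed.

    Let the stabilizer of [u] be contained in that of [v], where [u] and [v] lie
    in different orbits.  The path from [u] to [v] is fixed by the stabilizer of
    [u], so its first edge [t] has the same stabilizer as [u].  Unless [t] can be
    collapsed already, it is an ascending loop in the quotient: its end [x] is a
    translate of [u], and the stabilizer of [t] has some finite index [m] in the
    infinite cyclic stabilizer of [x].

    Call an oriented edge smooth if it starts in the orbit of [x] and its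
    stabilizer has, in that of its initial vertex, an index that divides a power
    of [m].  On the path from [x] to a translate of [v] fixed by the stabilizer of
    [x] there is an edge [f] such that [f] is smooth and [bar f] is not
    ([exit_edge]).  Up to translation it starts at [x].

    The main tool ([induction_move]) is an expansion followed by a collapse.
    Expand [x] by a new vertex whose group is the product of the stabilizers of
    [f] and [t], move [f] and [bar t] to it, and collapse [t].  The expansion edge
    becomes an ascending loop with the same [m], smoothness is preserved, and if
    the index of [f] divides [m ^ a] with [a > 0], afterwards it divides
    [m ^ a.-1].  After finitely many such moves [f] has index 1.  If [f] then
    leads out of the orbit of [x], it can be collapsed.  Otherwise one more move
    makes [f] an ascending loop whose label is a multiple of [m]; with respect to
    that loop every edge that was smooth is still smooth, and so is [bar f].
    Hence the number of orbits of nonsmooth edges drops, and the process stops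
    ([ascending_reduces]).

    Expansions and collapses are seen to be trees through a criterion that
    behaves well under both: a connected graph is a tree if and only if each of
    its edges separates its ends ([separated_tree], [tree_separated]). *)

Set Implicit Arguments.
Unset Strict Implicit.
Unset Printing Implicit Defensive.

Local Open Scope classical_set_scope.

(** * Subgroups of infinite cyclic groups *)

Section Cyclic.
Variable G : groupType.
Implicit Types (A C D H : set G) (x y g : G).
Local Open Scope group_scope.

Definition is_subgroup A : Prop := A 1 /\ forall x y, A x -> A y -> A (x * y^-1).

(** For an infinite cyclic group and [k > 0], the subgroup of index [k]: labels
    of a graph of infinite cyclic groups are recorded through it, so that they
    need no choice of generators and are invariant under conjugation. *)
Definition powers k A : set G := [set x ^+ k | x in A].

Lemma is_subgroupV A x : is_subgroup A -> A x -> A x^-1.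
Proof. by move=> [A1 AD] Ax; rewrite -[_^-1]mul1g; apply: AD. Qed.

Lemma is_subgroupM A x y : is_subgroup A -> A x -> A y -> A (x * y).
Proof.
by move=> sA Ax Ay; rewrite -[y]invgK; apply: (proj2 sA) => //; apply: is_subgroupV.
Qed.

Lemma is_subgroupX A x k : is_subgroup A -> A x -> A (x ^+ k).
Proof.
move=> sA Ax; elim: k => [|k IH]; first by rewrite expg0; apply: (proj1 sA).
by rewrite expgS; apply: is_subgroupM.
Qed.

Lemma powers_powers k l A : powers k (powers l A) = powers (l * k) A.
Proof.
by rewrite /powers image_comp; congr image; apply/funext => x /=; rewrite expgnA.
Qed.

(** A generator of an infinite cyclic group has infinite order, since
    [g ^+ n = 1] with [n > 0] would leave only finitely many powers of [g]. *)
Lemma infinite_cyclicP C : infinite_cyclic C ->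
  exists g, [/\ is_subgroup C, C g,
    forall x, C x -> exists n, x = g ^+ n \/ x^-1 = g ^+ n &
    forall n, g ^+ n = 1 -> n = 0%N].
Proof.
move=> [Cinf [g CE]]; exists g.
have gX n : C (g ^+ n) by rewrite CE; exists n; left.
have gN n : C (g ^- n) by rewrite CE; exists n; right.
have CV x : C x -> C x^-1.
  rewrite {1}CE => -[n [->|->]]; first exact: gN.
  by rewrite invgK.
have cg n m : commute (g ^+ n) (g ^- m).
  by apply/commuteV; apply: commuteX2.
split.
- split=> [|x y]; first by rewrite -(expg0 g).
  suff CM u v : C u -> C v -> C (u * v) by move=> Cx Cy; apply: CM => //; apply: CV.
  have CB n m : C (g ^+ n * g ^- m).
    have [le|/ltnW le] := leqP m n.
      by rewrite -(subnK le) expgnDr mulgK.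
    by rewrite -(subnK le) expgnDr invgM mulVKg.
  rewrite {1 2}CE => -[n [->|->]] [m [->|->]].
  + by rewrite -expgnDr.
  + exact: CB.
  + by rewrite -cg.
  + by rewrite -invgM -expgnDr.
- by rewrite -(expg1 g).
- rewrite CE => x -[n [->|->]]; exists n; first by left.
  by right; rewrite invgK.
move=> n gn; case: n gn => // n gn; case: Cinf.
have gmod k : g ^+ k = g ^+ (k %% n.+1).
  by rewrite {1}(divn_eq k n.+1) expgnDr mulnC expgnA gn expg1n mul1g.
apply: (@sub_finite_set _ _ ((fun k => g ^+ k) @` `I_n.+1)); last first.
  exact/finite_image/finite_II.
rewrite CE => x [k [->|->]].
  by exists (k %% n.+1)%N; rewrite /= ?ltn_mod -?gmod.
exists ((k * n) %% n.+1)%N; rewrite /= ?ltn_mod -?gmod //.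
apply: (mulgI (g ^+ k)); rewrite mulgV -expgnDr -mulnS mulnC expgnA gn.
exact: expg1n.
Qed.

Lemma infinite_cyclic_comm C x y :
  infinite_cyclic C -> C x -> C y -> commute x y.
Proof.
case/infinite_cyclicP => g [_ _ gen _].
have cV (u v : G) : commute u^-1 v -> commute u v.
  by move=> /commute_sym/commuteV/commute_sym; rewrite invgK.
move=> /gen[n xE] /gen[m yE].
suff c : commute (g ^+ n) (g ^+ m).
  have c1 (u : G) : commute u (g ^+ m) -> commute u y.
    case: yE => [->//|yE cu]; apply/commute_sym/cV; rewrite yE.
    exact: commute_sym.
  by apply: c1; case: xE => [->//|xE]; apply: cV; rewrite xE.
exact: commuteX2.
Qed.

(** The least positive exponent [k] for which [g ^+ k] lies in [D] divides
    every other such exponent, by division with remainder; it exists because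
    [D] is not trivial. *)
Lemma infinite_cyclic_subgroup C D : infinite_cyclic C -> is_subgroup D ->
  D `<=` C -> infinite_set D ->
  infinite_cyclic D /\ exists2 k, (0 < k)%N & D = powers k C.
Proof.
move=> Ccyc sD DC Dinf; have [g [sC Cg gen ginf]] := infinite_cyclicP Ccyc.
have genD x : D x -> exists n, D (g ^+ n) /\ (x = g ^+ n \/ x^-1 = g ^+ n).
  move=> Dx; have [n xE] := gen x (DC x Dx); exists n; split=> //.
  by case: xE => <- //; apply: is_subgroupV.
have exn : exists n, (0 < n)%N && `[< D (g ^+ n) >].
  apply: contrapT => no; apply: Dinf.
  apply: (@sub_finite_set _ _ [set 1]); last exact: finite_set1.
  move=> x /genD[[|n] [Dn xE]] /=; last first.
    by case: no; exists n.+1; apply/andP; split => //; apply/asboolP.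
  case: xE; rewrite expg0 // => xV.
  by rewrite -[x]invgK xV invg1.
have [k /andP[k0 /asboolP Dk] kmin] := ex_minnP exn.
have dvdk n : D (g ^+ n) -> (k %| n)%N.
  move=> Dn; rewrite /dvdn; case: posnP => // r0.
  have : (k <= n %% k)%N.
    apply: kmin; rewrite r0; apply/asboolP.
    have -> : g ^+ (n %% k) = (g ^+ k ^+ (n %/ k))^-1 * g ^+ n.
      by rewrite {3}(divn_eq n k) expgnDr mulnC expgnA mulKg.
    by apply: is_subgroupM => //; apply: is_subgroupV => //; apply: is_subgroupX.
  by rewrite leqNgt ltn_mod k0.
have DE x : D x <-> exists n, x = (g ^+ k) ^+ n \/ x = (g ^+ k) ^- n.
  split=> [/genD[n [/dvdk/dvdnP[q ->]]]|[n [->|->]]].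
  - rewrite mulnC expgnA => xE; exists q; case: xE => xE; [by left|right].
    by rewrite -xE invgK.
  - exact: is_subgroupX.
  - by apply: is_subgroupV => //; apply: is_subgroupX.
split; first by split=> //; exists (g ^+ k); apply/seteqP; split=> x /DE.
exists k => //; apply/seteqP; split=> [x /DE[n xE]|_ [x Cx <-]].
  case: xE => ->.
    by exists (g ^+ n); [exact: is_subgroupX | rewrite -!expgnA mulnC].
  exists (g ^- n); first by apply: is_subgroupV => //; apply: is_subgroupX.
  by rewrite expVgn -!expgnA mulnC.
have [n [->|xE]] := gen x Cx; first by rewrite -expgnA mulnC expgnA; apply: is_subgroupX.
rewrite -[x]invgK xE expVgn -expgnA mulnC expgnA.
by apply: is_subgroupV => //; apply: is_subgroupX.
Qed.

(** Inclusion of one set of powers in another means divisibility of the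
    exponents, because powers of a generator determine their exponents. *)
Lemma powers_inj C k l : infinite_cyclic C -> (0 < k)%N -> (0 < l)%N ->
  powers k C = powers l C -> k = l.
Proof.
move=> Ccyc; have [g [sC Cg gen ginf]] := infinite_cyclicP Ccyc.
have ginj n m : g ^+ n = g ^+ m -> n = m.
  wlog le : n m / (n <= m)%N => [th|].
    by have [/th//|/ltnW/th h /esym/h] := leqP n m.
  rewrite -{1}(subnK le) expgnDr -[LHS]mul1g => /mulIg /esym/ginf h.
  by apply/eqP; rewrite eqn_leq le -subn_eq0 h.
have gV n m : g ^+ n = g ^- m -> n = 0%N.
  move=> nm; have : g ^+ (n + m) = 1 by rewrite expgnDr nm mulVg.
  by move/ginf/eqP; rewrite addn_eq0 => /andP[/eqP].
have dvd k' l' : (0 < k')%N -> powers k' C `<=` powers l' C -> (l' %| k')%N.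
  move=> k0 kl; have [|x Cx xk] := kl (g ^+ k'); first by exists g.
  have [n [xE|xE]] := gen x Cx.
    by move: xk; rewrite xE -expgnA => /ginj <-; apply: dvdn_mull.
  by move: xk; rewrite -[x]invgK xE expVgn -expgnA => /esym/gV k'0; rewrite k'0 in k0.
move=> k0 l0 kl; apply/eqP; rewrite eqn_dvd.
by rewrite !dvd // kl.
Qed.

Lemma infinite_cyclic_expgM C x y n : infinite_cyclic C -> C x -> C y ->
  (x * y) ^+ n = x ^+ n * y ^+ n.
Proof. by move=> Cc Cx Cy; apply: expgMn; apply: (infinite_cyclic_comm Cc). Qed.

End Cyclic.

(** * Trees as graphs in which every edge separates *)

Section Trees.
Variables (G : groupType) (X : Ggraph G).
Implicit Types (u v : vertex X) (e f : edge X) (p q : seq (edge X)).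

Lemma d1_bar e : d1 (bar e) = d0 e.
Proof. by rewrite -d0_bar barK. Qed.

Lemma is_path_cat u p q v :
  is_path u (p ++ q) v <-> exists w, is_path u p w /\ is_path w q v.
Proof.
elim: p u => [|e p IH] u /=; split.
- by exists u.
- by move=> [_ [<-]].
- by move=> [eu /IH[w [? ?]]]; exists w.
- by move=> [w [[? ?] ?]]; split=> //; apply/IH; exists w.
Qed.

Lemma reduced_behead e p : reduced (e :: p) -> reduced p.
Proof. by case: p => //= f p []. Qed.

Lemma reduced_prefix p q : reduced (p ++ q) -> reduced p.
Proof.
elim: p => //= e [|f p] //= IH [fe]; split=> //; exact: IH.
Qed.

Definition connected : Prop :=
  (exists v : vertex X, True) /\ forall u v, exists p, is_path u p v.

(** [P] is the half of the graph beyond [e], without [e] itself.  Unlike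
    reducedness of paths, this passes easily to collapses and expansions. *)
Definition separates e (P : vertex X -> Prop) : Prop :=
  [/\ ~ P (d0 e), P (d1 e) &
      forall f, f <> e -> f <> bar e -> (P (d0 f) <-> P (d1 f))].

Lemma separates_bar e P : separates e P -> separates (bar e) (fun v => ~ P v).
Proof.
move=> [P0 P1 Pf]; split; rewrite ?d0_bar ?d1_bar //.
move=> f f1; rewrite barK => f2; have [PP PP'] := Pf f f2 f1.
by split=> nP Pd; apply: nP; auto.
Qed.

(** A path that leaves the half beyond [e] does so across [bar e]; what
    precedes the first crossing is a path that ends where [e] ends. *)
Lemma separates_cross e P u p v : separates e P ->
  is_path u p v -> P u -> ~ P v ->
  exists p1 p2, p = p1 ++ bar e :: p2 /\ is_path u p1 (d1 e).
Proof.
move=> [P0 P1 Pf]; elim: p u => [|f p IH] u /= => [-> //|[fu pth] Pu Pv].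
have [Pf1|nPf1] := EM (P (d1 f)).
  have [p1 [p2 [-> pth1]]] := IH _ pth Pf1 Pv.
  by exists (f :: p1), p2.
have [fe|fe] := EM (f = e); first by rewrite -fu fe in Pu.
have [fe'|fe'] := EM (f = bar e).
  by exists [::], p; rewrite fe' /= -fu fe' d0_bar.
by case: nPf1; apply/(Pf f fe fe'); rewrite fu.
Qed.

(** A reduced closed path that starts with [e] must return across [bar e]; the
    part before that return is a shorter reduced closed path, hence empty, so
    [bar e] follows [e] immediately. *)
Lemma separated_tree :
  connected -> (forall e, exists P, separates e P) -> is_tree X.
Proof.
move=> [X0 Xc] sep; split=> // v p; have [n] := ubnP (size p).
elim: n v p => // n IH v [//|e p] /= szp [ev pth] red.
have [P eP] := sep e; have [P0 P1 _] := eP.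
rewrite -ev in pth.
have [p1 [p2 [pE pth1]]] := separates_cross eP pth P1 P0.
have p10 : p1 = [::].
  apply: (IH (d1 e)) => //; last first.
    by apply: (@reduced_prefix _ (bar e :: p2)); rewrite -pE; apply: reduced_behead red.
  apply: leq_ltn_trans (_ : size p < n)%N; last by rewrite -ltnS.
  by rewrite pE size_cat leq_addr.
by move: red; rewrite pE p10 /= => -[].
Qed.

(** The predicate [Q] keeps track of the edges that the given path avoids. *)
Lemma reduce_path (Q : edge X -> Prop) u p v : is_path u p v -> List.Forall Q p ->
  exists p', [/\ is_path u p' v, List.Forall Q p' & reduced p'].
Proof.
elim: p u => [|e p IH] u /= => [uv _|[eu pth] Qp]; first by exists [::].
have [p' [pth' Qp' red']] := IH _ pth (List.Forall_inv_tail Qp).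
have Qe := List.Forall_inv Qp.
case: p' pth' Qp' red' => [|f p'] pth' Qp' red'.
  by exists [:: e]; split => //; constructor.
have [fe|fe] := EM (f = bar e); last by exists [:: e, f & p']; split => //; constructor.
exists p'; split; last exact: reduced_behead red'.
- by move: pth'; rewrite /= fe d1_bar eu => -[].
- exact: List.Forall_inv_tail Qp'.
Qed.

Hypothesis Xtree : is_tree X.

Lemma tree_connected : connected.
Proof. by case: Xtree. Qed.

Lemma closed_reduced v p : is_path v p v -> reduced p -> p = [::].
Proof. by case: Xtree => _ _; apply. Qed.

(** The half beyond [e] consists of the vertices reached from [d1 e] by paths
    that avoid [e] and [bar e]; if [d0 e] were one of them, the reduced form of
    such a path would close up with [e] to a reduced closed path. *)
Lemma tree_separated e : exists P, separates e P.
Proof.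
exists (fun v => exists p, is_path (d1 e) p v /\
  List.Forall (fun f => f <> e /\ f <> bar e) p); split.
- move=> [p [pth av]].
  have [p' [pth' av' red']] := reduce_path pth av.
  suff : e :: p' = [::] by [].
  apply: (@closed_reduced (d0 e)) => //.
  by case: p' av' red' {pth'} => //= f p' av' red'; have [] := List.Forall_inv av'.
- by exists [::].
- suff ext f p v : is_path (d1 e) p v ->
      List.Forall (fun f => f <> e /\ f <> bar e) p -> d0 f = v ->
      f <> e -> f <> bar e -> exists p, is_path (d1 e) p (d1 f) /\
      List.Forall (fun f => f <> e /\ f <> bar e) p.
    move=> f f1 f2; split=> -[p [pth av]]; first exact: ext pth av _ f1 f2.
    rewrite -d1_bar; apply: ext pth av _ _ _; first by rewrite d0_bar.
      by move=> fe; apply: f2; rewrite -fe barK.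
    by move=> fe; apply: f1; rewrite -[f]barK fe barK.
  move=> pth av fv f1 f2; exists (p ++ [:: f]); split.
    by apply/is_path_cat; exists v.
  by apply/List.Forall_app; split => //; constructor.
Qed.

(** If the first edges [e] and [f] were different, then the end [v] would lie
    beyond [f], and the path through [e] could get there only across [f], after
    a nonempty reduced closed path. *)
Lemma reduced_path_unique u p q v : is_path u p v -> is_path u q v ->
  reduced p -> reduced q -> p = q.
Proof.
elim: p u q => [|e p IH] u q /=.
  by move=> -> pq _ rq; rewrite (closed_reduced pq rq).
case: q => [|f q] /=.
  move=> pth uv; rewrite -uv in pth => r.
  by rewrite -(closed_reduced (p := e :: p) pth r).
move=> [eu pth] [fu qth] rp rq.
have [P fP] := tree_separated f; have [P0 P1 _] := fP.
have Pv : P v.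
  apply: contrapT => nPv.
  have [q1 [q2 [qE q1th]]] := separates_cross fP qth P1 nPv.
  have q10 : q1 = [::].
    apply: closed_reduced q1th _; apply: (@reduced_prefix _ (bar f :: q2)).
    by rewrite -qE; apply: reduced_behead rq.
  by move: rq; rewrite qE q10 /= => -[].
have [p1 [p2 []]] : exists p1 p2,
    e :: p = p1 ++ bar (bar f) :: p2 /\ is_path u p1 (d1 (bar f)).
  apply: (@separates_cross (bar f) (fun v => ~ P v)) => //.
  - exact: separates_bar.
  - by split; [exact: eu|exact: pth].
  - by rewrite -fu.
  - by apply.
rewrite d1_bar barK fu => pE p1th.
have p10 : p1 = [::].
  by apply: closed_reduced p1th _; apply: (@reduced_prefix _ (f :: p2)); rewrite -pE.
move: pE; rewrite p10 => -[ef _]; rewrite -ef in qth rq *.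
by rewrite (IH _ _ pth qth) //; apply: reduced_behead; eassumption.
Qed.

Lemma is_path_act g u p v :
  is_path u p v -> is_path (actV g u) (map (actE g) p) (actV g v).
Proof.
by elim: p u => [|e p IH] u /= => [->|[<- /IH]] //; rewrite d0_act d1_act.
Qed.

Lemma reduced_act g p : reduced p -> reduced (map (actE g) p).
Proof.
elim: p => //= e [|f p] //= IH [fe red]; split; last exact: IH.
rewrite bar_act => h; apply: fe.
by rewrite -[f]actE1 -(mulVg g) actEM h -actEM mulVg actE1.
Qed.

(** An element that fixes both ends maps the reduced path to a reduced path
    with the same ends, hence to itself. *)
Lemma fixed_path u v : exists p, is_path u p v /\
  List.Forall (fun e => stabV u `&` stabV v `<=` stabE e) p.
Proof.
have [p0 p0th] := tree_connected.2 u v.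
have [|p [pth _ red]] := @reduce_path (fun=> True) _ _ _ p0th.
  by elim: (p0) => //; constructor.
exists p; split=> //.
have : forall g, (stabV u `&` stabV v) g -> map (actE g) p = p.
  move=> g [gu gv]; apply: (@reduced_path_unique u _ _ v) => //; last exact: reduced_act.
  by have := is_path_act g pth; rewrite gu gv.
elim: (p) => [|e p' IH] h; constructor.
  by move=> g /h -[].
by apply: IH => g /h [].
Qed.

End Trees.
(** * Orbits and stabilizers *)

Section Action.
Variables (G : groupType) (X : Ggraph G).
Implicit Types (u v : vertex X) (e f : edge X).
Local Open Scope group_scope.

Lemma actVK g v : actV g^-1 (actV g v) = v.
Proof. by rewrite -actVM mulVg actV1. Qed.

Lemma actVKV g v : actV g (actV g^-1 v) = v.
Proof. by rewrite -actVM mulgV actV1. Qed.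

Lemma actEK g e : actE g^-1 (actE g e) = e.
Proof. by rewrite -actEM mulVg actE1. Qed.

Lemma actEKV g e : actE g (actE g^-1 e) = e.
Proof. by rewrite -actEM mulgV actE1. Qed.

Lemma orbitVx g v : orbitV v (actV g v).
Proof. by exists g. Qed.

Lemma orbitV_refl v : orbitV v v.
Proof. by exists 1; rewrite ?actV1. Qed.

Lemma orbitV_sym u v : orbitV u v -> orbitV v u.
Proof. by move=> [g _ <-]; exists g^-1; rewrite ?actVK. Qed.

Lemma orbitV_trans u v w : orbitV u v -> orbitV v w -> orbitV u w.
Proof. by move=> [g _ <-] [h _ <-]; exists (h * g); rewrite ?actVM. Qed.

Lemma orbitV_eq u v : orbitV u v -> orbitV u = orbitV v.
Proof.
move=> uv; apply/seteqP; split=> w; last exact: orbitV_trans.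
by apply: orbitV_trans; apply: orbitV_sym.
Qed.

Lemma orbitE_refl e : orbitE e e.
Proof. by exists 1; rewrite ?actE1. Qed.

Lemma orbitE_sym e f : orbitE e f -> orbitE f e.
Proof. by move=> [g _ <-]; exists g^-1; rewrite ?actEK. Qed.

Lemma orbitE_trans e f h : orbitE e f -> orbitE f h -> orbitE e h.
Proof. by move=> [g _ <-] [k _ <-]; exists (k * g); rewrite ?actEM. Qed.

Lemma orbitE_bar e f : orbitE e (bar f) <-> orbitE (bar e) f.
Proof.
have h e' f' : orbitE e' (bar f') -> orbitE (bar e') f'.
  by move=> [g _ gE]; exists g => //; rewrite -bar_act gE barK.
by split=> [|H]; [exact: h|rewrite -[e]barK; apply: h; rewrite barK].
Qed.

Lemma orbitE_barF e : ~ orbitE e (bar e).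
Proof. by move=> [g _]; apply: no_inversion. Qed.

Lemma stabV_act g v h : stabV (actV g v) h <-> stabV v (h ^ g).
Proof.
rewrite /stabV /= conjgE !actVM; split=> [->|H]; first by rewrite actVK.
by rewrite -{2}H actVKV.
Qed.

Lemma stabE_act g e h : stabE (actE g e) h <-> stabE e (h ^ g).
Proof.
rewrite /stabE /= conjgE !actEM; split=> [->|H]; first by rewrite actEK.
by rewrite -{2}H actEKV.
Qed.

Lemma stabE_bar e : stabE (bar e) = stabE e.
Proof.
apply/seteqP; split=> g; rewrite /stabE /= => H; last by rewrite -bar_act H.
by rewrite -[e]barK -bar_act H.
Qed.

Lemma stabE_d0 e : stabE e `<=` stabV (d0 e).
Proof. by move=> g; rewrite /stabE /stabV /= -d0_act => ->. Qed.

Lemma stabE_d1 e : stabE e `<=` stabV (d1 e).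
Proof. by move=> g; rewrite /stabE /stabV /= -d1_act => ->. Qed.

Lemma is_subgroup_stabV v : is_subgroup (stabV v).
Proof.
split=> [|g h]; rewrite /stabV /= ?actV1 // => gv hv.
by rewrite actVM -{1}hv actVK.
Qed.

Lemma is_subgroup_stabE e : is_subgroup (stabE e).
Proof.
split=> [|g h]; rewrite /stabE /= ?actE1 // => gv hv.
by rewrite actEM -{1}hv actEK.
Qed.

Lemma stabV_act_sub g u v :
  stabV u `<=` stabV v -> stabV (actV g u) `<=` stabV (actV g v).
Proof. by move=> uv h /stabV_act/uv/stabV_act. Qed.

End Action.

(** * Counting orbits of edges *)

Section Orbits.
Variables (G : groupType).
Implicit Types (X Y : Ggraph G).

(** A bound on the number of orbits of edges that satisfy [P], witnessed by a
    colouring that separates those orbits. *)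
Definition orbits_le X (P : edge X -> Prop) n : Prop :=
  exists c : edge X -> nat, (forall f, P f -> c f < n) /\
    forall f f', P f -> P f' -> c f = c f' -> orbitE f f'.

Lemma orbits_le_transfer X Y (P : edge X -> Prop) (Q : edge Y -> Prop) n
    (phi : edge Y -> edge X) :
  (forall f f', orbitE (phi f) (phi f') -> orbitE f f') ->
  (forall f, Q f -> P (phi f)) ->
  orbits_le P n -> orbits_le Q n.
Proof.
move=> phi_inj QP [c [cn cinj]]; exists (c \o phi); split=> [f /QP|f f' Qf Qf' /= cE].
  exact: cn.
by apply: phi_inj; apply: cinj => //; apply: QP.
Qed.

(** The last colour is replaced by the colour of [f0], which becomes free once
    the orbit of [f0] is left out. *)
Lemma orbits_le_remove X (P : edge X -> Prop) n f0 :
  orbits_le P n -> P f0 ->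
  exists2 n', n = n'.+1 & orbits_le (fun f => P f /\ ~ orbitE f0 f) n'.
Proof.
case=> c [cn cinj] P0; case: n cn => [|n] cn; first by have := cn _ P0.
exists n => //; exists (fun f => if c f == n then c f0 else c f).
have c0 f : P f -> ~ orbitE f0 f -> c f0 <> c f by move=> Pf n0 /cinj H; apply/n0/H.
split=> [f [Pf n0]|f f' [Pf n0] [Pf' n0']].
  case: eqP => [cf|/eqP cf]; last by rewrite ltn_neqAle cf -ltnS cn.
  rewrite ltn_neqAle -ltnS cn // andbT.
  by apply/eqP => cf0; apply: (c0 f Pf n0); rewrite cf0.
case: eqP => [cf|_]; case: eqP => [cf'|_].
- by move=> _; apply: cinj => //; rewrite cf'.
- by move/(c0 f' Pf' n0').
- by move/esym/(c0 f Pf n0).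
- exact: cinj.
Qed.

Lemma cocompact_orbits X : cocompact X -> exists n, orbits_le (fun=> True) n (X := X).
Proof.
move=> [_ /finite_set_leP[n /pcard_leP[F]]]; exists n; exists (fun f => F (orbitE f)).
split=> [f _|f f' _ _ FE].
  by have /(_ (orbitE f)) := @funS _ _ _ _ F; apply; exists f.
have : orbitE f = orbitE f'.
  by apply: (@inj _ _ _ F); rewrite // inE; [exists f|exists f'].
by move=> ->; apply: orbitE_refl.
Qed.

End Orbits.

(** * Collapses *)

Section CollapseTree.
Variables (G : groupType) (X : Ggraph G) (e : edge X).

Lemma cclass_eq u v : cclass e u v -> cclass e u = cclass e v.
Proof.
move=> uv; apply/seteqP; split=> w; last exact: rst_trans.
by apply: rst_trans; apply: rst_sym.
Qed.

Lemma cproj_eq u v : cproj e u = cproj e v <-> cclass e u v.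
Proof.
split=> [/(congr1 sval)/= ->|uv]; first exact: rst_refl.
by apply: sval_inj; apply: cclass_eq.
Qed.

Lemma cprojP (C : cvertex e) : exists v, C = cproj e v.
Proof. by have [v vC] := svalP C; exists v; apply: sval_inj. Qed.

Lemma actV_cproj g v : @actV _ (collapse e) g (cproj e v) = cproj e (actV g v).
Proof. by apply: sval_inj; rewrite /= cclass_image. Qed.

(** The half beyond a surviving edge is a union of classes of collapsed
    vertices, so it descends to the quotient. *)
Lemma collapse_is_tree : is_tree X -> is_tree (collapse e).
Proof.
move=> Xt; apply: separated_tree.
  split=> [|C D]; first by have [[v _] _] := tree_connected Xt; exists (cproj e v).
  have [u ->] := cprojP C; have [v ->] := cprojP D.
  have [p] := (tree_connected Xt).2 u v.
  elim: p u => [|f p IH] u /= => [->|[fu /IH[q qP]]]; first by exists [::].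
  have [fc|fc] := EM (collapsed e f).
    exists q; rewrite (_ : cproj e u = cproj e (d1 f)) //; apply/cproj_eq.
    by apply: rst_step; exists f.
  exists ((exist _ f fc : edge (collapse e)) :: q); split=> //.
  by rewrite /= /cd0 /= fu.
move=> [f fc]; have [P [P0 P1 Pf]] := tree_separated Xt f.
have Pc u v : cclass e u v -> (P u <-> P v).
  elim=> [{}u {}v [k [kc <- <-]]|w|{}u {}v _ IH|{}u w {}v _ IH1 _ IH2].
  - apply: Pf => kE; apply: fc; rewrite -?kE //.
    by rewrite kE in kc; rewrite -collapsed_bar.
  - by [].
  - by rewrite IH.
  - by rewrite IH1.
pose Q (C : vertex (collapse e)) := exists v, sval C v /\ P v.
have QE v : Q (cproj e v) <-> P v.
  split=> [[w [/Pc vw /vw//]]|Pv]; exists v; split=> //; exact: rst_refl.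
exists Q; split.
- by move/QE.
- exact/QE.
- move=> [k kc] k1 k2; rewrite !QE; apply: Pf => kE.
    by apply: k1; apply: sval_inj.
  by apply: k2; apply: sval_inj.
Qed.

Lemma stabE_collapse (f : edge (collapse e)) : stabE f = stabE (sval f).
Proof.
apply/seteqP; split=> g; rewrite /stabE /=; first by move=> /(congr1 sval).
by move=> gf; apply: sval_inj.
Qed.

Lemma collapse_orbitE (f f' : edge (collapse e)) :
  orbitE (sval f) (sval f') -> orbitE f f'.
Proof. by move=> [g _ gE]; exists g => //; apply: sval_inj. Qed.

(** Only one of the two orientations of [e] is removed from the count, so this
    bound is not sharp; any decrease suffices for the induction. *)
Lemma collapse_orbits_le n : orbits_le (fun _ : edge X => True) n ->
  exists2 n', n = n'.+1 & orbits_le (fun _ : edge (collapse e) => True) n'.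
Proof.
move=> /orbits_le_remove/(_ (I : (fun=> True) e))[n' -> H]; exists n' => //.
apply: orbits_le_transfer collapse_orbitE _ H => f _; split=> // ef.
by apply: (svalP f); left.
Qed.

Hypothesis e_stab : stabE e = stabV (d1 e).
Hypothesis e_orb : ~ orbitV (d1 e) (d0 e).

(** The equality of stabilizers makes [actV g (d1 e)] determine
    [actV g (d0 e)].  The retraction selects from every class of the collapse
    its only vertex outside the orbit of [d1 e]. *)
Lemma retraction_exists : exists rho : vertex X -> vertex X,
  (forall g, rho (actV g (d1 e)) = actV g (d0 e)) /\
  (forall v, ~ orbitV (d1 e) v -> rho v = v).
Proof.
exists (fun v => match pselect (exists g, actV g (d1 e) = v) with
  | left ex => actV (projT1 (cid ex)) (d0 e) | right _ => v end); split.
  move=> g; case: pselect => [ex|[]]; last by exists g.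
  have := projT2 (cid ex); move: (projT1 _) => h hg /=.
  have : stabE e (g^-1 * h)%g by rewrite e_stab /stabV /= actVM hg actVK.
  by move/stabE_d0; rewrite /stabV /= actVM => H; rewrite -{2}H actVKV.
by move=> v nv; case: pselect => // -[g gE]; case: nv; exists g.
Qed.

Lemma cproj_act_d1 g : cproj e (actV g (d1 e)) = cproj e (actV g (d0 e)).
Proof.
apply/cproj_eq/rst_sym/rst_step; exists (actE g e).
by split; rewrite ?d0_act ?d1_act //; left; exists g.
Qed.

Lemma cproj_inj u v : ~ orbitV (d1 e) u -> ~ orbitV (d1 e) v ->
  cproj e u = cproj e v -> u = v.
Proof.
have [rho [rho1 rho0]] := retraction_exists.
have rho_e g : rho (actV g (d0 e)) = rho (actV g (d1 e)).
  rewrite rho1 rho0 // => H; apply: e_orb; apply: orbitV_trans H _.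
  exact/orbitV_sym/orbitVx.
move=> nu nv /cproj_eq uv; rewrite -(rho0 u nu) -(rho0 v nv) {nu nv}.
elim: uv => // [{}u {}v [f [[[g _ fE]|[g _ fE]] <- <-]]|{}u w {}v _ -> _ ->] //.
  by rewrite -fE d0_act d1_act rho_e.
by rewrite -d1_bar -(d0_bar f) -fE d0_act d1_act rho_e.
Qed.

Lemma cproj_rep (C : cvertex e) : exists v, ~ orbitV (d1 e) v /\ C = cproj e v.
Proof.
have [v ->] := cprojP C.
have [[g _ <-]|nv] := EM (orbitV (d1 e) v); last by exists v.
exists (actV g (d0 e)); rewrite cproj_act_d1; split=> // H; apply: e_orb.
by apply: orbitV_trans H _; apply/orbitV_sym/orbitVx.
Qed.

Lemma not_orbitV_act g v : ~ orbitV (d1 e) v -> ~ orbitV (d1 e) (actV g v).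
Proof.
by move=> nv H; apply: nv; apply: orbitV_trans H _; apply/orbitV_sym/orbitVx.
Qed.

(** With [cproj_rep], this computes every vertex stabilizer of a collapse:
    the vertices outside the orbit of [d1 e] represent all classes, each once,
    and keep their stabilizers. *)
Lemma stabV_cproj v : ~ orbitV (d1 e) v ->
  @stabV _ (collapse e) (cproj e v) = stabV v.
Proof.
move=> nv; apply/seteqP; split=> g H.
  by apply: cproj_inj => //; [exact: not_orbitV_act|rewrite -actV_cproj H].
exact: etrans (actV_cproj g v) (congr1 (cproj e) H).
Qed.

Lemma orbitV_cproj u v : ~ orbitV (d1 e) u -> ~ orbitV (d1 e) v ->
  @orbitV _ (collapse e) (cproj e u) (cproj e v) -> orbitV u v.
Proof.
move=> nu nv [g _]; rewrite actV_cproj => H; exists g => //.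
by apply: cproj_inj => //; apply: not_orbitV_act.
Qed.

End CollapseTree.

Section CollapseMove.
Variables (G : groupType) (X : Gtree G) (e : edge X).
Hypothesis e_stab : stabE e = stabV (d1 e).
Hypothesis e_orb : ~ orbitV (d1 e) (d0 e).

Definition collapseT : Gtree G := MkGtree (@collapse_is_tree _ X e (Gtree_is_tree X)).

Lemma isomorphic_refl (Y : Ggraph G) : isomorphic Y Y.
Proof. by constructor; apply: (@MkGiso _ Y Y id id) => //; exists id. Qed.

Lemma collapseT_move : collapse_move X collapseT.
Proof.
exists e; split=> //; last exact: isomorphic_refl.
by move=> H; apply: e_orb; rewrite -H; apply: orbitV_refl.
Qed.

Lemma collapseT_GBS : is_GBS X -> is_GBS collapseT.
Proof.
move=> [XV XE]; split=> [C|f]; last by rewrite stabE_collapse.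
by have [v [nv ->]] := cproj_rep e_orb C; rewrite stabV_cproj.
Qed.

End CollapseMove.
(** * Expansions *)

Section Expand.
(** The new vertices form a [G]-set [I]; the vertex [i] is joined by a new edge
    to [base i], and [att] tells which edges are moved from [base i] to [i].
    The boolean of a new edge gives its orientation: [true] points to the new
    vertex. *)
Variables (G : groupType) (X : Ggraph G) (I : Type) (actI : G -> I -> I).
Variables (base : I -> vertex X) (att : edge X -> option I).
Hypothesis actI1 : forall i, actI 1%g i = i.
Hypothesis actIM : forall g h i, actI (g * h)%g i = actI g (actI h i).
Hypothesis base_act : forall g i, base (actI g i) = actV g (base i).
Hypothesis att_act : forall g f, att (actE g f) = omap (actI g) (att f).
Hypothesis att_base : forall f i, att f = Some i -> base i = d0 f.

Definition xvertex : Type := vertex X + I.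
Definition xedge : Type := edge X + I * bool.

Definition xd0 (f : xedge) : xvertex :=
  match f with
  | inl f => if att f is Some i then inr i else inl (d0 f)
  | inr (i, true) => inl (base i)
  | inr (i, false) => inr i
  end.

Definition xbar (f : xedge) : xedge :=
  match f with inl f => inl (bar f) | inr (i, b) => inr (i, ~~ b) end.

Definition xd1 (f : xedge) : xvertex := xd0 (xbar f).

Definition xactV g (v : xvertex) : xvertex :=
  match v with inl v => inl (actV g v) | inr i => inr (actI g i) end.

Definition xactE g (f : xedge) : xedge :=
  match f with inl f => inl (actE g f) | inr (i, b) => inr (actI g i, b) end.

Lemma xbarK f : xbar (xbar f) = f.
Proof. by case: f => [f|[i b]] /=; rewrite ?barK ?negbK. Qed.

Lemma xbar_neq f : xbar f <> f.
Proof. by case: f => [f [] /bar_neq|[i []] []]. Qed.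

Lemma xd0_bar f : xd0 (xbar f) = xd1 f. Proof. by []. Qed.

Lemma xactV1 v : xactV 1%g v = v.
Proof. by case: v => [v|i] /=; rewrite ?actV1 ?actI1. Qed.

Lemma xactVM g h v : xactV (g * h)%g v = xactV g (xactV h v).
Proof. by case: v => [v|i] /=; rewrite ?actVM ?actIM. Qed.

Lemma xactE1 f : xactE 1%g f = f.
Proof. by case: f => [f|[i b]] /=; rewrite ?actE1 ?actI1. Qed.

Lemma xactEM g h f : xactE (g * h)%g f = xactE g (xactE h f).
Proof. by case: f => [f|[i b]] /=; rewrite ?actEM ?actIM. Qed.

Lemma xd0_act g f : xd0 (xactE g f) = xactV g (xd0 f).
Proof.
case: f => [f|[i []]] /=; rewrite ?base_act //.
by rewrite att_act d0_act; case: (att f).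
Qed.

Lemma xbar_act g f : xbar (xactE g f) = xactE g (xbar f).
Proof. by case: f => [f|[i b]] //=; rewrite bar_act. Qed.

Lemma xd1_act g f : xd1 (xactE g f) = xactV g (xd1 f).
Proof. by rewrite /xd1 xbar_act xd0_act. Qed.

Lemma xno_inversion g f : xactE g f <> xbar f.
Proof. by case: f => [f [] /no_inversion|[i []] []]. Qed.

Definition expand : Ggraph G :=
  MkGgraph xbarK xbar_neq xd0_bar xactV1 xactVM xactE1 xactEM
    xd0_act xd1_act xbar_act xno_inversion.

Definition xproj (v : xvertex) : vertex X :=
  match v with inl v => v | inr i => base i end.

Lemma xproj_d0 f : xproj (xd0 (inl f)) = d0 f.
Proof. by rewrite /=; case E: (att f) => [i|] //=; apply: att_base. Qed.

Lemma xproj_d1 f : xproj (xd1 (inl f)) = d1 f.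
Proof. by rewrite /xd1 xproj_d0 d0_bar. Qed.

Lemma expand_connected : connected X -> connected expand.
Proof.
move=> [[v0 _] Xc]; split; first by exists (inl v0).
pose R (v w : vertex expand) := exists p, is_path v p w.
have Rrefl v : R v v by exists [::].
have Rtrans v w z : R v w -> R w z -> R v z.
  by move=> [p pP] [q qP]; exists (p ++ q); apply/is_path_cat; exists w.
have Re (f : edge expand) : R (d0 f) (d1 f) by exists [:: f].
have Rproj v : R v (inl (xproj v)) /\ R (inl (xproj v)) v.
  case: v => [v|i] /=; first by split; apply: Rrefl.
  by split; [exact: (Re (inr (i, false)))|exact: (Re (inr (i, true)))].
have Rlift u v : R (inl u) (inl v).
  have [p] := Xc u v; elim: p u => [|f p IH] u /= => [->|[<- /IH Rv]]; first exact: Rrefl.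
  apply: (Rtrans) Rv; rewrite -(xproj_d0 f) -(xproj_d1 f).
  apply: (Rtrans) (Rproj (xd1 (inl f))).1; apply: (Rtrans) (Rproj (xd0 (inl f))).2 _.
  exact: (Re (inl f)).
move=> v w; apply: (Rtrans) (Rproj v).1 _; apply: (Rtrans) (Rproj w).2; exact: Rlift.
Qed.

(** Old edges are separated by the pullback along [xproj] of their old halves.
    The half beyond a new edge to [i] consists of [i] and of everything beyond
    some edge that was moved to [i]. *)
Lemma expand_is_tree : is_tree X -> is_tree expand.
Proof.
move=> Xt; apply: separated_tree; first exact/expand_connected/tree_connected.
have sep_true i : exists P, separates (inr (i, true) : edge expand) P.
  (* The half beyond an edge is unique, so all [P] may be asked to hold. *)
  pose far v := exists f, att f = Some i /\
    forall P, separates f P -> P v.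
  pose Q (v : vertex expand) := v = inr i \/ far (xproj v).
  have nfar : ~ far (base i).
    move=> [f [fi H]]; have [P fP] := tree_separated Xt f.
    by have [P0 _ _] := fP; apply: P0; rewrite -(att_base fi); apply: H.
  have noloop (f : edge X) : d0 f <> d1 f.
    by have [P [P0 P1 _]] := tree_separated Xt f => E; apply: P0; rewrite E.
  have far_step f : att f <> Some i -> att (bar f) <> Some i ->
      far (d0 f) -> far (d1 f).
    move=> f1 f2 [k [ki H]]; exists k; split=> // P kP.
    have [_ _ Pf] := kP; apply/Pf; last exact: H.
      by move=> fk; apply: f1; rewrite fk.
    by move=> fk; apply: f2; rewrite fk barK.
  have Qd0 f : att f <> Some i -> Q (xd0 (inl f)) <-> far (d0 f).
    move=> fi; rewrite /Q xproj_d0; split=> [[|//]|]; last by right.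
    by rewrite /=; case E: (att f) => [j|] // [ji]; rewrite ji in E.
  have Qstep f : Q (xd0 (inl f)) -> Q (xd0 (inl (bar f))).
    have [fi|fi] := EM (att f = Some i).
      move=> _; have fbi : att (bar f) <> Some i.
        by move=> /att_base; rewrite (att_base fi) d0_bar; apply: noloop.
      apply/(Qd0 _ fbi); exists f; split=> // P [_ P1 _].
      by rewrite d0_bar.
    move/(Qd0 _ fi) => H.
    have [fbi|fbi] := EM (att (bar f) = Some i).
      by left; rewrite /= fbi.
    by apply/(Qd0 _ fbi); rewrite d0_bar; apply: far_step.
  exists Q; split.
  - by case.
  - by left.
  - case=> [f _ _|[j b] f1 f2].
      split; first exact: Qstep.
      by move/Qstep; rewrite barK.
    have ji : j <> i by move=> ji; move: f1 f2; rewrite ji; case: (b).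
    have QE : Q (inr j) <-> Q (inl (base j)) by split=> -[[]|H] //; right.
    by case: (b); split=> /QE.
case=> [f|[i [|]]]; first last.
- have [P /separates_bar iP] := sep_true i; exists (fun v => ~ P v); exact: iP.
- exact: sep_true.
have [P [P0 P1 Pf]] := tree_separated Xt f.
exists (P \o xproj); split.
- by rewrite /= (xproj_d0 f).
- by rewrite [d1 _]/(xd1 (inl f)) /= (xproj_d1 f).
- case=> [k|[j b]] k1 k2; last by case: b {k1 k2}.
  rewrite /comp [d1 _]/(xd1 (inl k)) [d0 _]/(xd0 (inl k)) xproj_d1 xproj_d0.
  by apply: Pf => kf; [apply: k1|apply: k2]; rewrite kf.
Qed.

Variable i0 : I.
Hypothesis transI : forall i, exists g, actI g i0 = i.

Let eps : edge expand := inr (i0, true).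

Lemma collapsed_eps (f : edge expand) :
  collapsed eps f <-> if f is inr _ then True else False.
Proof.
case: f => [f|[i b]]; first by split=> // -[[g _]|[g _]].
split=> // _; have [g gi] := transI i.
by case: b; [left|right]; exists g; rewrite //= gi.
Qed.

Lemma cclass_eps v w : cclass eps v w -> xproj v = xproj w.
Proof.
elim=> [{}v {}w [f [/collapsed_eps fc <- <-]]|//|//|{}v u {}w _ -> _ ->] //.
by case: f fc => // -[i []].
Qed.

Lemma cclass_xproj v : cclass eps v (inl (xproj v)).
Proof.
case: v => [v|i]; first exact: rst_refl.
by apply: rst_step; exists (inr (i, false)); split => //; apply/collapsed_eps.
Qed.

(** As [I] is a single orbit, collapsing one new edge collapses them all, and
    [xproj] becomes bijective on vertices. *)
Lemma collapse_expand : isomorphic (collapse eps) X.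
Proof.
pose fV (C : vertex (collapse eps)) := xproj (projT1 (cid (svalP C))).
have fVE v : fV (cproj eps v) = xproj v.
  rewrite /fV; move: (cid _) => [w /= wC]; apply/esym/cclass_eps.
  by rewrite wC; apply: rst_refl.
have fE_ex (f : edge (collapse eps)) : exists k, sval f = inl k.
  by case: f => -[k|j] fc; [exists k|case: fc; apply/collapsed_eps].
pose fE f := projT1 (cid (fE_ex f)).
have fEE f : sval f = inl (fE f) by exact: (projT2 (cid (fE_ex f))).
have ncoll k : ~ collapsed eps (inl k) by move/collapsed_eps.
pose gE k : edge (collapse eps) := exist _ (inl k) (ncoll k).
have fEP f k : sval f = inl k -> fE f = k by rewrite fEE => -[].
constructor; apply: (@MkGiso _ _ _ fV fE).
- exists (fun v => cproj eps (inl v)) => [C|v]; last exact: fVE.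
  have [v ->] := cprojP C; rewrite fVE; apply/cproj_eq/rst_sym.
  exact: cclass_xproj.
- exists gE => [f|k]; last exact: fEP.
  by apply: sval_inj; rewrite /= -fEE.
- by move=> f; rewrite [d0 f]/(cd0 f) fVE fEE -xproj_d0.
- by move=> f; rewrite [d1 f]/(cd1 f) fVE fEE -xproj_d1.
- by move=> f; apply/esym/fEP; rewrite /= fEE.
- move=> g C; have [v ->] := cprojP C.
  rewrite actV_cproj !fVE; by case: v => //= i; rewrite base_act.
- by move=> g f; apply/esym/fEP; rewrite /= fEE.
Qed.

End Expand.
(** * Ascending loops and smooth edges *)

Section Ascending.
Variables (G : groupType).
Implicit Types X Y : Ggraph G.

(** In the quotient graph of groups, [t] is a loop at the image of [x] with
    labels 1 and [m]. *)
Definition ascending X (x : vertex X) m (t : edge X) : Prop :=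
  [/\ d1 t = x, orbitV x (d0 t), stabE t = stabV (d0 t)
    & stabE t = powers m (stabV x)].

(** When the stabilizer of [d0 f] is infinite cyclic, the second condition says
    that the index of the stabilizer of [f] in it divides a power of [m]. *)
Definition smooth X (x : vertex X) m (f : edge X) : Prop :=
  orbitV x (d0 f) /\ exists a, powers (m ^ a) (stabV (d0 f)) `<=` stabE f.

Lemma powers_stabV_act X Y g m (v : vertex X) (w : vertex Y) :
  stabV v = powers m (stabV w) -> stabV (actV g v) = powers m (stabV (actV g w)).
Proof.
move=> vw; apply/seteqP; split=> [h /stabV_act|_ [h /stabV_act hw <-]].
  rewrite vw => -[k kw kE]; exists (k ^ g^-1)%g.
    by apply/stabV_act; rewrite conjgKV.
  by rewrite -conjXg kE conjgK.
by apply/stabV_act; rewrite vw; exists (h ^ g)%g; rewrite // conjXg.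
Qed.

Lemma smooth_act X (x : vertex X) m g f : smooth x m f -> smooth x m (actE g f).
Proof.
move=> [xf [a fa]]; split; first by rewrite d0_act; apply: orbitV_trans xf (orbitVx _ _).
exists a => _ [h hf <-]; apply/stabE_act; apply: fa; rewrite conjXg.
by exists (h ^ g)%g => //; apply/stabV_act; rewrite -d0_act.
Qed.

Lemma smooth_orbitE X (x : vertex X) m f f' :
  orbitE f f' -> smooth x m f <-> smooth x m f'.
Proof.
by move=> [g _ <-]; split=> [|/(smooth_act g^-1)]; rewrite ?actEK //; apply: smooth_act.
Qed.

Lemma smooth_ascending X (x : vertex X) m t :
  ascending x m t -> smooth x m t /\ smooth x m (bar t).
Proof.
move=> [t1 xt ts tm]; split; split=> //; rewrite ?d0_bar ?stabE_bar.
- by exists 0; rewrite -ts expn0 => _ [g gt <-]; rewrite expg1.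
- by rewrite t1; apply: orbitV_refl.
- by exists 1; rewrite expn1 t1 tm.
Qed.

End Ascending.

(** * Moving an edge and an ascending loop to a smaller vertex group *)

Section InductionMove.
(** The tree is expanded at [x] by a new vertex whose group is the product [D] of
    the stabilizers of [f] and [t]; the edges [f] and [bar t] are moved to it.
    Then [t] joins different orbits and fills the group of its initial vertex,
    hence it can be collapsed, and the expansion edge becomes an ascending loop
    with the same label [m]. *)
Variables (G : groupType) (X : Gtree G) (x : vertex X) (m : nat) (t f : edge X).
Hypothesis XGBS : is_GBS X.
Hypothesis m0 : 0 < m.
Hypothesis tP : ascending x m t.
Hypothesis f0 : d0 f = x.
Hypothesis fsmooth : smooth x m f.
Hypothesis fbad : ~ smooth x m (bar f).
Local Open Scope group_scope.

Let xcyc : infinite_cyclic (stabV x) := XGBS.1 x.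

(** Both ends of an ascending loop are smooth, whereas [bar f] is not. *)
Lemma f_not_orbit_t : ~ orbitE f t.
Proof.
move=> ft; have ftb : orbitE (bar f) (bar t) by apply/orbitE_bar; rewrite barK.
by apply: fbad; apply/(smooth_orbitE _ _ ftb); have [] := smooth_ascending tP.
Qed.

Lemma f_not_orbit_bart : ~ orbitE f (bar t).
Proof.
move=> /orbitE_bar ft; apply: fbad; apply/(smooth_orbitE _ _ ft).
by have [] := smooth_ascending tP.
Qed.

(** The least subgroup that contains both stabilizers; it is a subgroup because
    the stabilizer of [x] is abelian. *)
Definition stab_prod : set G := [set a * b | a in stabE f & b in stabE t].

Lemma stab_prod_stabV : stab_prod `<=` stabV x.
Proof.
have [t1 _ _ _] := tP.
move=> _ [a fa [b tb <-]]; apply: is_subgroupM; first exact: is_subgroup_stabV.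
  by rewrite -f0; apply: stabE_d0.
by rewrite -t1; apply: stabE_d1.
Qed.

Lemma stabE_stab_prod_f : stabE f `<=` stab_prod.
Proof.
by move=> a fa; exists a => //; exists 1; rewrite ?mulg1 // /stabE /= actE1.
Qed.

Lemma stabE_stab_prod_t : stabE t `<=` stab_prod.
Proof.
by move=> a ta; exists 1; rewrite /stabE /= ?actE1 //; exists a; rewrite ?mul1g.
Qed.

Lemma is_subgroup_stab_prod : is_subgroup stab_prod.
Proof.
split; first by apply: stabE_stab_prod_f; apply: (is_subgroup_stabE f).1.
move=> _ _ [a fa [b tb <-]] [c fc [d td <-]].
exists (a * c^-1); first by apply: (is_subgroup_stabE f).2.
exists (b * d^-1); first by apply: (is_subgroup_stabE t).2.
have tx k : stabE t k -> stabV x k by move/stabE_stab_prod_t/stab_prod_stabV.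
have fx k : stabE f k -> stabV x k by move/stabE_stab_prod_f/stab_prod_stabV.
have cbd : commute (b * d^-1) c^-1.
  apply: (infinite_cyclic_comm xcyc); first exact/tx/(is_subgroup_stabE t).2.
  exact/fx/(is_subgroupV (is_subgroup_stabE f)).
by rewrite invgM !mulgA -(mulgA a b) -(mulgA a (b * _)) cbd !mulgA.
Qed.

Lemma infinite_stab_prod : infinite_set stab_prod.
Proof. exact: sub_infinite_set stabE_stab_prod_t (XGBS.2 t).1. Qed.

(** The edges at [x] that are moved to the new vertex.  Its translates serve as
    the new vertices, since the setwise stabilizer of the bundle is the
    intended vertex group. *)
Definition bundle : set (edge X) :=
  [set k | exists2 g, stab_prod g & k = actE g f \/ k = actE g (bar t)].

Lemma bundle_d0 k : bundle k -> d0 k = x.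
Proof.
have [t1 _ _ _] := tP.
by move=> [g /stab_prod_stabV gx [->|->]]; rewrite d0_act ?d0_bar ?t1 ?f0.
Qed.

Lemma bundle_orbit k : bundle k -> orbitE f k \/ orbitE (bar t) k.
Proof. by move=> [g _ [->|->]]; [left|right]; exists g. Qed.

Lemma bundle_stable g : stab_prod g -> actE g @` bundle = bundle.
Proof.
have sub h : stab_prod h -> actE h @` bundle `<=` bundle.
  move=> Dh _ [_ [k Dk [->|->]] <-]; exists (h * k); rewrite ?actEM; auto;
    exact: is_subgroupM is_subgroup_stab_prod Dh Dk.
move=> Dg; apply/seteqP; split; first exact: sub.
move=> k kS; exists (actE g^-1 k); last exact: actEKV.
by apply: (sub g^-1); [exact: is_subgroupV is_subgroup_stab_prod Dg|exists k].
Qed.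

(** The translates of the bundle partition its orbits: [f] and [bar t] lie in
    different orbits, and [D] contains the stabilizers of both. *)
Lemma bundle_meet g k : bundle k -> bundle (actE g k) -> stab_prod g.
Proof.
have key (e : edge X) h h' : stabE e `<=` stab_prod -> stab_prod h -> stab_prod h' ->
    actE g (actE h e) = actE h' e -> stab_prod g.
  move=> eD Dh Dh' gE; rewrite -(mulVKg h' g) -[_ * g](mulgK h).
  apply: is_subgroupM is_subgroup_stab_prod Dh' _; apply: (is_subgroup_stab_prod).2 => //.
  by apply: eD; rewrite /stabE /= !actEM gE actEK.
have no h h' : actE h f <> actE h' (bar t).
  move=> E; apply: f_not_orbit_bart.
  apply: (@orbitE_trans _ _ _ (actE h f)); first by exists h.
  by apply: orbitE_sym; exists h'.
have tbD : stabE (bar t) `<=` stab_prod by rewrite stabE_bar; apply: stabE_stab_prod_t.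
move=> [h Dh [->|->]] [h' Dh' [E|E]].
- exact: key stabE_stab_prod_f Dh Dh' E.
- by rewrite -actEM in E; case: (no _ _ E).
- by rewrite -actEM in E; case: (no _ _ (esym E)).
- exact: key tbD Dh Dh' E.
Qed.

Definition translate : Type := {B : set (edge X) | exists g, B = actE g @` bundle}.
Definition translate_by g : translate := exist _ (actE g @` bundle) (ex_intro _ g erefl).

Lemma translateP (B : translate) : exists g, B = translate_by g.
Proof. by have [g gB] := svalP B; exists g; apply: sval_inj. Qed.

Lemma translate_image g h : actE g @` (actE h @` bundle) = actE (g * h) @` bundle.
Proof. by rewrite image_comp; congr image; apply/funext => k /=; rewrite actEM. Qed.

Lemma translate_act_subproof g (B : translate) :
  exists h, actE g @` sval B = actE h @` bundle.
Proof. by have [h ->] := translateP B; exists (g * h); rewrite /= translate_image. Qed.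

Definition translate_act g (B : translate) : translate :=
  exist _ _ (translate_act_subproof g B).

Lemma translate_act_by g h : translate_act g (translate_by h) = translate_by (g * h).
Proof. by apply: sval_inj; rewrite /= translate_image. Qed.

Lemma translate_act1 B : translate_act 1 B = B.
Proof. by have [g ->] := translateP B; rewrite translate_act_by mul1g. Qed.

Lemma translate_actM g h B :
  translate_act (g * h) B = translate_act g (translate_act h B).
Proof. by have [k ->] := translateP B; rewrite !translate_act_by mulgA. Qed.

Lemma bundle_f : bundle f.
Proof. by exists 1; [exact: (is_subgroup_stab_prod).1|left; rewrite actE1]. Qed.

Lemma bundle_bart : bundle (bar t).
Proof. by exists 1; [exact: (is_subgroup_stab_prod).1|right; rewrite actE1]. Qed.

Lemma translate_by_meet g h k :
  sval (translate_by g) k -> sval (translate_by h) k -> stab_prod (g^-1 * h).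
Proof.
move=> [k1 k1S <-] [k2 k2S kE]; apply: (bundle_meet k2S).
by rewrite actEM kE actEK.
Qed.

Lemma translate_by_eq g h : translate_by g = translate_by h <-> stab_prod (g^-1 * h).
Proof.
split=> [gh|D]; last first.
  by apply: sval_inj; rewrite /= -{1}(bundle_stable D) translate_image mulVKg.
apply: (@translate_by_meet _ _ (actE g f)); rewrite -?gh; exists f => //;
  exact: bundle_f.
Qed.

Lemma translate_eq (B C : translate) k : sval B k -> sval C k -> B = C.
Proof.
have [g ->] := translateP B; have [h ->] := translateP C => gk hk.
exact/translate_by_eq/(translate_by_meet gk hk).
Qed.

Definition translate_base (B : translate) : vertex X :=
  actV (projT1 (cid (translateP B))) x.

Lemma translate_baseE g : translate_base (translate_by g) = actV g x.
Proof.
rewrite /translate_base; move: (cid _) => [h /= /translate_by_eq/stab_prod_stabV].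
by rewrite /stabV /= actVM => gh; rewrite -{2}gh actVKV.
Qed.

Definition translate_of (k : edge X) : option translate :=
  match pselect (exists B : translate, sval B k) with
  | left ex => Some (projT1 (cid ex)) | right _ => None end.

Lemma translate_ofP k B : translate_of k = Some B <-> sval B k.
Proof.
rewrite /translate_of; case: pselect => [ex|no]; last first.
  by split=> // kB; case: no; exists B.
case: (cid ex) => C /= kC; split=> [[<-]//|kB]; congr Some; exact: translate_eq kC kB.
Qed.

Lemma translate_of_None k : ~ (orbitE f k \/ orbitE (bar t) k) -> translate_of k = None.
Proof.
move=> no; case E: translate_of => [B|] //; case: no; move/translate_ofP: E.
have [g ->] := translateP B; move=> [k' /bundle_orbit k'o <-].
by case: k'o => H; [left|right]; apply: orbitE_trans H _; exists g.
Qed.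

Lemma translate_base_act g B :
  translate_base (translate_act g B) = actV g (translate_base B).
Proof.
by have [h ->] := translateP B; rewrite translate_act_by !translate_baseE actVM.
Qed.

Lemma translate_of_act g k :
  translate_of (actE g k) = omap (translate_act g) (translate_of k).
Proof.
case E: (translate_of k) => [B|] /=.
  by apply/translate_ofP; exists k => //; apply/translate_ofP.
case E' : translate_of => [B|] //.
suff : translate_of k = Some (translate_act g^-1 B) by rewrite E.
by apply/translate_ofP; exists (actE g k); [apply/translate_ofP|rewrite actEK].
Qed.

Lemma translate_of_base k B : translate_of k = Some B -> translate_base B = d0 k.
Proof.
move/translate_ofP; have [g ->] := translateP B; move=> [k' /bundle_d0 k'0 <-].
by rewrite translate_baseE d0_act k'0.
Qed.

Definition expanded_graph : Ggraph G :=
  expand translate_act1 translate_actM translate_base_act translate_of_act.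

Lemma expanded_is_tree : is_tree expanded_graph.
Proof. exact: (expand_is_tree _ _ _ _ translate_of_base (Gtree_is_tree X)). Qed.

Definition expanded : Gtree G := MkGtree expanded_is_tree.

Lemma stabV_expanded_old v : @stabV _ expanded_graph (inl v) = stabV v.
Proof. by apply/seteqP; split=> g; rewrite /stabV /=; [case|move=> ->]. Qed.

Lemma stabE_expanded_old k : @stabE _ expanded_graph (inl k) = stabE k.
Proof. by apply/seteqP; split=> g; rewrite /stabE /=; [case|move=> ->]. Qed.

Lemma stabE_expanded_new B b :
  @stabE _ expanded_graph (inr (B, b)) = @stabV _ expanded_graph (inr B).
Proof.
apply/seteqP; split=> g; rewrite /stabE /stabV /=.
  by case=> H; congr inr.
by case=> H; congr inr; rewrite H.
Qed.

Lemma stabV_expanded_new g h :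
  @stabV _ expanded_graph (inr (translate_by g)) h <-> stab_prod (h ^ g).
Proof.
have E : @stabV _ expanded_graph (inr (translate_by g)) h <->
    translate_by g = translate_by (h * g).
  rewrite /stabV /= -translate_act_by; split=> [|H]; last by rewrite -H.
  move/(congr1 (fun v : vertex expanded_graph =>
    if v is inr B then B else translate_by g)).
  by [].
by rewrite E conjgE translate_by_eq.
Qed.

Lemma stabV_expanded_bundle : @stabV _ expanded_graph (inr (translate_by 1)) = stab_prod.
Proof. by apply/seteqP; split=> h; rewrite stabV_expanded_new conjg1. Qed.

Lemma expanded_GBS : is_GBS expanded.
Proof.
have cycI B : infinite_cyclic (@stabV _ expanded_graph (inr B)).
  have [g ->] := translateP B.
  have sub : @stabV _ expanded_graph (inr (translate_by g)) `<=` stabV (actV g x).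
    by move=> h /stabV_expanded_new/stab_prod_stabV/stabV_act.
  have /= [] // := infinite_cyclic_subgroup (XGBS.1 _)
    (@is_subgroup_stabV _ expanded_graph _) sub.
  apply: sub_infinite_set (XGBS.2 (actE g f)).1 => h.
  by move=> /stabE_act/stabE_stab_prod_f/stabV_expanded_new.
split=> [[v|B]|[k|[B b]]] //.
- by rewrite [stabV _]stabV_expanded_old; apply: XGBS.1.
- by rewrite [stabE _]stabE_expanded_old; apply: XGBS.2.
- by rewrite [stabE _]stabE_expanded_new.
Qed.

Lemma expanded_move : elementary_move X expanded.
Proof.
right; exists (inr (translate_by 1, true) : edge expanded_graph); split.
- by rewrite stabE_expanded_new.
- have x0 : @orbitV _ expanded_graph (inl (translate_base (translate_by 1))) (inl x).
    by exists 1; rewrite //= translate_baseE !actV1.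
  by move=> H; case: (eq_ind _ (fun A => A (inl x)) x0 _ H).
- apply: (collapse_expand _ _ _ _ translate_of_base) => B.
  by have [g ->] := translateP B; exists g; rewrite translate_act_by mulg1.
Qed.

Let e : edge expanded := inl (bar t).

Lemma translate_of_t : translate_of t = None.
Proof.
by apply: translate_of_None => -[/f_not_orbit_t|/orbitE_sym/orbitE_barF].
Qed.

Lemma translate_of_barf : translate_of (bar f) = None.
Proof.
apply: translate_of_None => -[/orbitE_barF//|/orbitE_bar/orbitE_sym].
by rewrite barK => /f_not_orbit_t.
Qed.

Lemma translate_of_bundle k : bundle k -> translate_of k = Some (translate_by 1).
Proof. by move=> kS; apply/translate_ofP; exists k; rewrite ?actE1. Qed.

Lemma d1_e : d1 e = inl (d0 t).
Proof. by rewrite /e /= /xd1 /= barK translate_of_t. Qed.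

Lemma d0_e : d0 e = inr (translate_by 1).
Proof. by rewrite /e /= (translate_of_bundle bundle_bart). Qed.

Lemma e_stab : stabE e = stabV (d1 e).
Proof.
have [_ _ ts _] := tP.
by rewrite [stabE e]stabE_expanded_old stabE_bar d1_e [RHS]stabV_expanded_old.
Qed.

Lemma not_orbitV_new B : ~ orbitV (d1 e) (inr B).
Proof. by rewrite d1_e => -[]. Qed.

Lemma e_orb : ~ orbitV (d1 e) (d0 e).
Proof. by rewrite d0_e; apply: not_orbitV_new. Qed.

Lemma not_orbitV_old v : ~ orbitV x v -> ~ orbitV (d1 e) (inl v).
Proof.
have [_ xt _ _] := tP.
rewrite d1_e => nv [g _ [gv]]; apply: nv; apply: orbitV_trans xt _; by exists g.
Qed.

(** The vertex orbit of [x] is absorbed by that of the new vertex, because the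
    collapsed edge ends in the orbit of [x]. *)
Definition moved : Gtree G := collapseT e.
(** The image of the new vertex; it takes over the role of [x]. *)
Definition moved_vertex : vertex moved := cproj e (inr (translate_by 1)).

Lemma moved_GBS : is_GBS moved.
Proof. exact: collapseT_GBS e_stab e_orb expanded_GBS. Qed.

Lemma moved_move : elementary_move expanded moved.
Proof. by left; apply: collapseT_move e_stab e_orb. Qed.

Lemma stabV_moved_vertex : stabV moved_vertex = stab_prod.
Proof.
rewrite [LHS](stabV_cproj e_stab e_orb (@not_orbitV_new _)).
exact: stabV_expanded_bundle.
Qed.

Lemma cproj_orbit_x g : cproj e (inl (actV g (d0 t))) = actV g moved_vertex.
Proof.
have := cproj_act_d1 e g; rewrite d1_e d0_e => H.
by rewrite [RHS]actV_cproj -H.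
Qed.

Lemma stabV_cproj_inl v : ~ orbitV x v ->
  @stabV _ moved (cproj e (inl v)) = stabV v.
Proof.
move=> /not_orbitV_old nv.
by rewrite [LHS](stabV_cproj e_stab e_orb nv) stabV_expanded_old.
Qed.

Lemma orbitV_moved_vertex v : orbitV moved_vertex (cproj e (inl v)) <-> orbitV x v.
Proof.
have [_ [g0 _ xt] _ _] := tP.
split=> [H|[g _ gv]].
  apply: contrapT => /not_orbitV_old nv.
  by case: (orbitV_cproj e_stab e_orb (@not_orbitV_new _) nv H).
exists (g * g0^-1) => //; rewrite -cproj_orbit_x; congr cproj; congr inl.
by rewrite -xt actVM actVK.
Qed.

(** Edge orbits of the new tree are matched with those of the old one; the
    expansion edge takes the place of [t], with the new vertex as its initial
    vertex. *)
Definition old_edge (k : edge moved) : edge X :=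
  match sval k with
  | inl k => k | inr (_, b) => if b then bar t else t end.

Lemma collapsed_old k :
  collapsed e (inl k) <-> orbitE (bar t) k \/ orbitE t k.
Proof.
have H k' : orbitE e (inl k') <-> orbitE (bar t) k'.
  by split=> -[g _]; [case=> <-; exists g|move=> <-; exists g].
split=> -[].
- by move/H; left.
- by move/(H (bar k))/orbitE_bar; rewrite barK; right.
- by move=> tk; left; apply/H.
- by move=> tk; right; apply/(H (bar k))/orbitE_bar; rewrite barK.
Qed.

Lemma old_edge_inj (k k' : edge moved) : orbitE (old_edge k) (old_edge k') -> orbitE k k'.
Proof.
have old_t (j : edge moved) c b :
    sval j = inl c -> ~ orbitE c (if b then bar t else t).
  move=> jc ctb; 
  have nc : ~ collapsed e (inl c) :=
    eq_ind _ (fun z => ~ collapsed e z) (svalP j) _ jc.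
  by apply/nc/collapsed_old; case: b ctb => /orbitE_sym; auto.
move=> H; apply: collapse_orbitE; move: H; rewrite /old_edge.
case E: (sval k) => [c|[B b]]; case E': (sval k') => [c'|[B' b']].
- by move=> [g _ gc]; exists g; rewrite //= gc.
- by move/(old_t _ _ b' E).
- by move/orbitE_sym/(old_t _ _ b E').
- move=> bb; have {bb} -> : b = b'.
    case: b b' bb {E E'} => -[] //; first by move/orbitE_sym/orbitE_barF.
    by move/orbitE_barF.
  have [g ->] := translateP B; have [g' ->] := translateP B'.
  by exists (g' * g^-1) => //; rewrite [LHS]/= translate_act_by mulgVK.
Qed.

(** With [d] the index of [D] in the stabilizer of [x] and [e'] the index of
    the stabilizer of [t] in [D], multiplicativity of indices gives
    [e' * d = m]. *)
Lemma stab_prod_powers : exists d e',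
  [/\ stab_prod = powers d (stabV x), stabE t = powers e' stab_prod
    & (e' * d)%N = m].
Proof.
have [_ _ _ tm] := tP.
have [Dcyc [d d0 dE]] :=
  infinite_cyclic_subgroup xcyc is_subgroup_stab_prod stab_prod_stabV infinite_stab_prod.
have [_ [e' e0 eE]] :=
  infinite_cyclic_subgroup Dcyc (is_subgroup_stabE t) stabE_stab_prod_t (XGBS.2 t).1.
exists d, e'; split=> //; apply: (powers_inj xcyc) => //; first by rewrite muln_gt0 e0.
by rewrite mulnC -powers_powers -dE -eE.
Qed.

Lemma not_collapsed_f : ~ collapsed e (inl f).
Proof.
by move/collapsed_old => -[/orbitE_sym/f_not_orbit_bart|/orbitE_sym/f_not_orbit_t].
Qed.

Lemma not_collapsed_new B b : ~ collapsed e (inr (B, b)).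
Proof. by case=> -[]. Qed.

Definition moved_edge k (kc : ~ collapsed e k) : edge moved := exist _ k kc.
Definition moved_f : edge moved := moved_edge not_collapsed_f.
Definition moved_t g : edge moved :=
  moved_edge (@not_collapsed_new (translate_by g) false).

Lemma moved_f_d0 : d0 moved_f = moved_vertex.
Proof. by rewrite [LHS]/(cproj e _) /= (translate_of_bundle bundle_f). Qed.

Lemma moved_f_d1 : d1 moved_f = cproj e (inl (d1 f)).
Proof. by rewrite [LHS]/(cproj e _) /= /xd1 /= translate_of_barf d0_bar. Qed.

Lemma stabE_moved_f : stabE moved_f = stabE f.
Proof. by rewrite stabE_collapse [LHS]stabE_expanded_old. Qed.

(** The expansion edge has label 1 at the new vertex and label [d] at [x].  As
    [x] is identified with a translate of the new vertex in whose stabilizer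
    its own has index [e'], the second label becomes [e' * d]. *)
Lemma moved_ascending : exists g, ascending moved_vertex m (moved_t g).
Proof.
have [_ [g _ gx] ts tm] := tP; exists g.
have [d [e' [dE eE de]]] := stab_prod_powers.
have t1 : d1 (moved_t g) = moved_vertex.
  rewrite [LHS]/(cproj e (inl (translate_base (translate_by g)))) translate_baseE gx.
  by have := cproj_orbit_x 1; rewrite !actV1.
have t0 : d0 (moved_t g) = actV g moved_vertex.
  rewrite [RHS](actV_cproj e g); congr (cproj e (inr _)).
  by rewrite translate_act_by mulg1.
have ss : stabE (moved_t g) = stabV (actV g moved_vertex).
  rewrite stabE_collapse [LHS]stabE_expanded_new; apply/seteqP.
  by split=> h; rewrite stabV_expanded_new stabV_act stabV_moved_vertex.
split=> //; rewrite ?t0 //; first exact: orbitVx.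
rewrite ss (powers_stabV_act g (etrans stabV_moved_vertex dE)) gx -ts eE powers_powers de.
by rewrite stabV_moved_vertex.
Qed.

Lemma smooth_moved_f : smooth moved_vertex m moved_f.
Proof.
have [_ [a fa]] := fsmooth; split; first by rewrite moved_f_d0; apply: orbitV_refl.
exists a; rewrite moved_f_d0 stabV_moved_vertex stabE_moved_f.
move=> _ [h /stab_prod_stabV hx <-].
by apply: fa; exists h; rewrite ?f0.
Qed.

(** The stabilizers at the vertices in the orbit of [x] change only up to an
    index that divides a power of [m]. *)
Lemma smooth_moved k : smooth moved_vertex m k <-> smooth x m (old_edge k).
Proof.
have [_ _ ts tm] := tP.
case: k => -[k|[B b]] kc; rewrite /old_edge /=; last first.
  have [tsmooth tbsmooth] := smooth_ascending tP.
  have [g tY] := moved_ascending; have [tYsmooth tYbsmooth] := smooth_ascending tY.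
  have Bg : exists h, translate_act h (translate_by g) = B.
    by have [h ->] := translateP B; exists (h * g^-1); rewrite translate_act_by mulgVK.
  split=> _; first by case: (b).
  have [h hB] := Bg; case: b kc => kc.
    have kO : orbitE (bar (moved_t g)) (moved_edge kc).
      by exists h => //; apply: sval_inj; rewrite /= hB.
    exact/(smooth_orbitE _ _ kO).
  have kO : orbitE (moved_t g) (moved_edge kc).
    by exists h => //; apply: sval_inj; rewrite /= hB.
  exact/(smooth_orbitE _ _ kO).
set kY := moved_edge kc.
have kYs : stabE kY = stabE k by rewrite stabE_collapse [LHS]stabE_expanded_old.
case E: (translate_of k) => [B|].
  have fk : orbitE f k.
    move/translate_ofP: E; have [g ->] := translateP B.
    move=> [k' /bundle_orbit [fk'|tk'] k'E].
      by apply: orbitE_trans fk' _; exists g.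
    case: (kc); apply/collapsed_old; left.
    by apply: orbitE_trans tk' _; exists g.
  have fkY : orbitE moved_f kY.
    by have [g _ gk] := fk; exists g => //; apply: sval_inj; rewrite /= gk.
  split=> _; first by apply/(smooth_orbitE _ _ fk).
  by apply/(smooth_orbitE _ _ fkY); apply: smooth_moved_f.
have k0 : d0 kY = cproj e (inl (d0 k)).
  by rewrite [LHS]/(cproj e _) /= E.
split=> -[xk [a ka]].
  have xk' : orbitV x (d0 k) by apply/orbitV_moved_vertex; rewrite -k0.
  split=> //; exists a => _ [h hk <-]; rewrite -kYs; apply: ka; exists h => //.
  have [g gk] : exists g, actV g (d0 t) = d0 k.
    have [_ xt _ _] := tP.
    by have [g _ gk] := orbitV_trans (orbitV_sym xt) xk'; exists g.
  rewrite k0 -gk cproj_orbit_x; apply/stabV_act; rewrite stabV_moved_vertex.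
  by apply: stabE_stab_prod_t; rewrite ts; apply/stabV_act; rewrite gk.
(* [m]-th powers of [D] fix [t], which has the old stabilizer of its initial
   vertex: one more factor [m] suffices. *)
split; first by rewrite k0; apply/orbitV_moved_vertex.
exists a.+1 => _ [h hk <-]; rewrite kYs expnS expgnA; apply: ka; exists (h ^+ m) => //.
have [g gk] : exists g, actV g (d0 t) = d0 k.
  have [_ xt _ _] := tP.
  by have [g _ gk] := orbitV_trans (orbitV_sym xt) xk; exists g.
rewrite -gk; apply/stabV_act; rewrite -ts tm conjXg; exists (h ^ g) => //.
apply: stab_prod_stabV; rewrite -stabV_moved_vertex; apply/stabV_act.
by rewrite -cproj_orbit_x gk -k0.
Qed.

(** An element of [D] is a product of an element that fixes [f] and of an
    [m]-th power in the stabilizer of [x]; the second factor saves one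
    exponent. *)
Lemma moved_f_exponent a : powers (m ^ a) (stabV x) `<=` stabE f ->
  powers (m ^ a.-1) (stabV moved_vertex) `<=` stabE moved_f.
Proof.
have [_ _ _ tm] := tP.
move=> fa; rewrite stabV_moved_vertex stabE_moved_f => _ [h Dh <-].
case: a fa => [|a] fa /=.
  (* [0.-1] is [0]: here [f] already has the full stabilizer of [x]. *)
  by apply: fa; exists h => //; apply: stab_prod_stabV.
case: Dh => p pf [q qt <-].
rewrite (infinite_cyclic_expgM _ xcyc); first last.
- exact/stab_prod_stabV/stabE_stab_prod_t.
- exact/stab_prod_stabV/stabE_stab_prod_f.
apply: is_subgroupM; first exact: is_subgroup_stabE.
  exact: is_subgroupX (is_subgroup_stabE f) pf.
by move: qt; rewrite tm => -[c cx <-]; apply: fa; exists c; rewrite // expnS expgnA.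
Qed.

(** Now [D] is the whole stabilizer of [x], so the move slides [f] off [x] onto
    the new vertex, while the label at the other end of [f] is multiplied by
    [m]. *)
Lemma moved_f_loop : stabE f = stabV x -> orbitV x (d1 f) ->
  exists2 q, 0 < q & ascending (d1 moved_f) (m * q) moved_f.
Proof.
have [_ xt ts tm] := tP.
move=> fs f1.
have Dx : stab_prod = stabV x.
  by apply/seteqP; split; [exact: stab_prod_stabV|rewrite -fs; exact: stabE_stab_prod_f].
have [_ [q q0 qE]] := infinite_cyclic_subgroup (XGBS.1 (d1 f)) (is_subgroup_stabE f)
  (@stabE_d1 _ _ f) (XGBS.2 f).1.
exists q => //; split=> //.
- rewrite moved_f_d0 moved_f_d1; apply/orbitV_sym/orbitV_moved_vertex => //.
- by rewrite stabE_moved_f moved_f_d0 stabV_moved_vertex Dx.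
have [g _ gk] := orbitV_trans (orbitV_sym xt) f1.
rewrite stabE_moved_f qE moved_f_d1 -gk cproj_orbit_x -powers_powers; congr powers.
by apply: powers_stabV_act; rewrite stabV_moved_vertex Dx -ts.
Qed.

Lemma moved_vertex_below v : ~ orbitV x v -> stabV x `<=` stabV v ->
  exists v', ~ orbitV moved_vertex v' /\ stabV moved_vertex `<=` stabV v'.
Proof.
move=> xv sv; exists (cproj e (inl v)); rewrite orbitV_moved_vertex stabV_cproj_inl //.
by split=> //; rewrite stabV_moved_vertex => h /stab_prod_stabV/sv.
Qed.

End InductionMove.
(** * Reduction to a fully reduced tree *)

Section Main.
Variable G : groupType.

(** The map [phi] matches edge orbits, so that the number of edge orbits and
    the number of nonsmooth ones do not grow. *)
Lemma induction_move (X : Gtree G) (x : vertex X) m t f a :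
  is_GBS X -> 0 < m -> ascending x m t -> d0 f = x ->
  powers (m ^ a) (stabV x) `<=` stabE f -> ~ smooth x m (bar f) ->
  exists (Y : Gtree G) (y : vertex Y) (f' : edge Y) (phi : edge Y -> edge X),
  [/\ is_GBS Y, exists Z, elementary_move X Z /\ elementary_move Z Y,
      forall k k', orbitE (phi k) (phi k') -> orbitE k k',
      forall k, smooth y m k <-> smooth x m (phi k)
    & phi (bar f') = bar f] /\
  [/\ exists t', ascending y m t', d0 f' = y,
      powers (m ^ a.-1) (stabV y) `<=` stabE f',
      stabE f = stabV x -> orbitV x (d1 f) ->
        exists2 q, 0 < q & ascending (d1 f') (m * q) f'
    & forall v, ~ orbitV x v -> stabV x `<=` stabV v ->
        exists v', ~ orbitV y v' /\ stabV y `<=` stabV v'].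
Proof.
move=> XGBS m0 tP f0 fa fbad.
have fsmooth : smooth x m f.
  by split; rewrite f0; [apply: orbitV_refl|exists a].
exists (moved XGBS tP f0 fbad), (moved_vertex XGBS tP f0 fbad).
exists (moved_f XGBS tP f0 fbad), (@old_edge _ _ _ _ _ _ XGBS tP f0 fbad).
split; split.
- exact: moved_GBS.
- by exists (expanded XGBS tP f0 fbad); split; [exact: expanded_move|exact: moved_move].
- exact: old_edge_inj.
- exact: smooth_moved.
- by [].
- have [g tY] := moved_ascending XGBS m0 tP f0 fbad.
  by exists (moved_t XGBS tP f0 fbad g).
- exact: moved_f_d0.
- exact: moved_f_exponent.
- exact: moved_f_loop.
- exact: moved_vertex_below.
Qed.

Definition reduces (X : Gtree G) : Prop :=
  exists Y : Gtree G, [/\ is_GBS Y, fully_reduced Y & deformation X Y].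

Lemma reduces_step (X Z : Gtree G) :
  elementary_move X Z -> reduces Z -> reduces X.
Proof.
by move=> XZ [Y [? ? ZY]]; exists Y; split=> //; apply: deformation_step XZ ZY.
Qed.

(** Along the path from [x] to [v] fixed by the stabilizer of [x], that
    stabilizer contains, for some [N], the [m ^ N]-th powers from the
    stabilizer of each vertex, as long as every edge is smooth at both ends.  This cannot last
    until [v], which lies in another orbit. *)
Lemma exit_edge (X : Gtree G) (x v : vertex X) m :
  ~ orbitV x v -> stabV x `<=` stabV v ->
  exists2 f, smooth x m f & ~ smooth x m (bar f).
Proof.
move=> xv sv; have [p [pth pfix]] := fixed_path (Gtree_is_tree X) x v.
have {pfix} : List.Forall (fun e => stabV x `<=` stabE e) p.
  elim: pfix => [|e q eq _ IH]; constructor=> //.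
  by move=> h hx; apply: eq; split; [|exact: sv].
have : exists N, powers (m ^ N) (stabV x) `<=` stabV x.
  by exists 0 => _ [h hx <-]; rewrite expn0 expg1.
move: (orbitV_refl x).
suff walk u : is_path u p v -> orbitV x u ->
    (exists N, powers (m ^ N) (stabV u) `<=` stabV x) ->
    List.Forall (fun e => stabV x `<=` stabE e) p ->
    exists2 f, smooth x m f & ~ smooth x m (bar f) by exact: walk.
elim: p u {pth} => [|e p IH] u /= => [-> //|[eu pth] xu [N uN] fixp].
have xe := List.Forall_inv fixp.
have [[xd1 [b eb]]|ebad] := EM (smooth x m (bar e)); last first.
  exists e => //; split; rewrite eu //; exists N => h /uN; exact: xe.
rewrite d0_bar stabE_bar in xd1 eb.
apply: IH pth xd1 _ (List.Forall_inv_tail fixp).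
exists (b + N) => _ [h hd1 <-]; rewrite expnD expgnA; apply: uN.
exists (h ^+ (m ^ b))%g => //; rewrite -eu; apply: stabE_d0.
by apply: eb; exists h.
Qed.

Section Bounded.
Variable n : nat.
Hypothesis reduces_collapse : forall (X : Gtree G) (e : edge X),
  is_GBS X -> orbits_le (fun _ : edge X => True) n ->
  stabE e = stabV (d1 e) -> ~ orbitV (d1 e) (d0 e) -> reduces X.

(** Induction on the number [b] of orbits of nonsmooth edges.  The edge [f] of
    [exit_edge] is moved until it fills its vertex group, by induction on the
    exponent [a].  Then either it leaves the orbit of [x] and can be collapsed,
    or one more move turns it into an ascending loop with label [m * q].  For
    that loop all edges that were smooth remain so, and [bar f] becomes smooth,
    whence [b] drops. *)
Lemma ascending_reduces b (X : Gtree G) (x v : vertex X) m t :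
  is_GBS X -> orbits_le (fun _ : edge X => True) n -> 0 < m ->
  ascending x m t -> orbits_le (fun k => ~ smooth x m k) b ->
  ~ orbitV x v -> stabV x `<=` stabV v -> reduces X.
Proof.
elim/ltn_ind: b X x v m t => b IHb X x v m t XGBS Xn m0 tP Xb xv sv.
suff stepB a (X' : Gtree G) (x' v' : vertex X') t' f :
    is_GBS X' -> orbits_le (fun _ : edge X' => True) n ->
    ascending x' m t' -> orbits_le (fun k => ~ smooth x' m k) b ->
    ~ orbitV x' v' -> stabV x' `<=` stabV v' ->
    d0 f = x' -> powers (m ^ a) (stabV x') `<=` stabE f ->
    ~ smooth x' m (bar f) -> reduces X'.
  have [f fsmooth fbad] := exit_edge m xv sv.
  have [[g _ gx] _] := fsmooth.
  have [_ [a fa]] := smooth_act g^-1%g fsmooth.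
  have f0 : d0 (actE g^-1%g f) = x by rewrite d0_act -gx actVK.
  rewrite f0 in fa; apply: stepB XGBS Xn tP Xb xv sv f0 fa _.
  rewrite bar_act => /(smooth_act g); rewrite actEKV; exact: fbad.
move=> {X x v t XGBS Xn tP Xb xv sv}.
elim: a X' x' v' t' f => [|a IHa] X x v t f XGBS Xn tP Xb xv sv f0 fa fbad.
  have fs : stabE f = stabV x.
    apply/seteqP; split=> [|h hx]; first by rewrite -f0; apply: stabE_d0.
    by apply: fa; exists h; rewrite // expn0 expg1.
  have [xf1|xf1] := EM (orbitV x (d1 f)); last first.
    apply: (@reduces_collapse X (bar f)) => //; rewrite d1_bar f0 ?d0_bar //.
    by rewrite stabE_bar.
  have [Y [y [f' [phi [[YGBS [Z [XZ ZY]] phi_inj phi_smooth phi_f]]]]]] :=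
    induction_move XGBS m0 tP f0 fa fbad.
  move=> [_ f'0 _ loop above].
  apply: (reduces_step XZ); apply: (reduces_step ZY).
  have [q q0 f'P] := loop fs xf1; have [v' [yv' sv']] := above v xv sv.
  have f'bad : ~ smooth y m (bar f') by rewrite phi_smooth phi_f.
  have Yb : orbits_le (fun k => ~ smooth y m k) b.
    by apply: orbits_le_transfer phi_inj _ Xb => k; rewrite phi_smooth.
  have [b' bE Yb'] := orbits_le_remove Yb f'bad.
  have [g _ gy] : orbitV y (d1 f').
    by have [_ H _ _] := f'P; rewrite -f'0; apply: orbitV_sym.
  apply: (IHb b' _ Y (d1 f') (actV g v') (m * q) f') => //.
  - by rewrite bE.
  - by apply: orbits_le_transfer phi_inj _ Xn.
  - by rewrite muln_gt0 m0.
  - apply: orbits_le_transfer (fun _ _ H => H) _ Yb' => k kbad; split.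
      move=> [yk [c kc]]; apply: kbad; split.
        by apply: orbitV_trans yk; apply: orbitV_sym; exists g.
      exists c => _ [h hk <-]; rewrite expnMn expgnA.
      by apply: is_subgroupX; [exact: is_subgroup_stabE|apply: kc; exists h].
    move=> f'k; apply: kbad; apply/(smooth_orbitE _ _ f'k).
    by have [] := smooth_ascending f'P.
  - rewrite -gy => H; apply: yv'; apply: orbitV_trans (orbitVx g y) _.
    by apply: orbitV_trans H _; apply/orbitV_sym/orbitVx.
  - by rewrite -gy; apply: stabV_act_sub.
have [Y [y [f' [phi [[YGBS [Z [XZ ZY]] phi_inj phi_smooth phi_f]]]]]] :=
  induction_move XGBS m0 tP f0 fa fbad.
move=> [[t' t'P] f'0 f'a _ above]; have [v' [yv' sv']] := above v xv sv.
apply: (reduces_step XZ); apply: (reduces_step ZY).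
apply: IHa t'P _ yv' sv' f'0 f'a _ => //.
- by apply: orbits_le_transfer phi_inj _ Xn.
- by apply: orbits_le_transfer phi_inj _ Xb => k; rewrite phi_smooth.
- by rewrite phi_smooth phi_f.
Qed.

End Bounded.

(** If the stabilizer of [u] is contained in that of [v], then the first edge
    of the path from [u] to [v] has the full stabilizer of [u]: it can be
    collapsed, or it is an ascending loop. *)
Lemma bounded_reduces n (X : Gtree G) :
  is_GBS X -> orbits_le (fun _ : edge X => True) n -> reduces X.
Proof.
elim/ltn_ind: n X => n IHn.
have coll (X : Gtree G) (e : edge X) : is_GBS X ->
    orbits_le (fun _ : edge X => True) n ->
    stabE e = stabV (d1 e) -> ~ orbitV (d1 e) (d0 e) -> reduces X.
  move=> XGBS Xn es eo; have [n' nE Yn] := collapse_orbits_le e Xn.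
  apply: (@reduces_step X (collapseT e)); first by left; apply: collapseT_move.
  by apply: (IHn n') => //; [rewrite nE|apply: collapseT_GBS].
move=> X XGBS Xn.
have [Xfr|Xnfr] := EM (fully_reduced X).
  by exists X; split=> //; apply: deformation_iso; apply: isomorphic_refl.
have [u [v [sv uv]]] : exists u v, stabV u `<=` stabV v /\ ~ @orbitV _ X u v.
  apply: contrapT => no; apply: Xnfr => u v sv; apply: orbitV_eq.
  by apply: contrapT => uv; apply: no; exists u, v.
have [[|e p] [/= pth pfix]] := fixed_path (Gtree_is_tree X) u v.
  by case: uv; rewrite pth; apply: orbitV_refl.
have [eu _] := pth; have es : stabE e = stabV (d0 e).
  apply/seteqP; split=> [|h]; first exact: stabE_d0.
  by rewrite eu => hu; apply: (List.Forall_inv pfix); split; [|exact: sv].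
have [[g _ ge]|ue1] := EM (orbitV u (d1 e)); last first.
  by apply: (coll X (bar e)) => //; rewrite d1_bar ?stabE_bar // d0_bar eu.
have [_ [m m0 em]] := infinite_cyclic_subgroup (XGBS.1 (d1 e)) (is_subgroup_stabE e)
  (@stabE_d1 _ _ e) (XGBS.2 e).1.
apply: (@ascending_reduces n coll n X (d1 e) (actV g v) m e) => //.
- by split=> //; rewrite eu -ge; apply/orbitV_sym/orbitVx.
- exact: orbits_le_transfer (fun _ _ H => H) _ Xn.
- rewrite -ge => H; apply: uv; apply: orbitV_trans (orbitVx g u) _.
  by apply: orbitV_trans H _; apply/orbitV_sym/orbitVx.
- by rewrite -ge; apply: stabV_act_sub.
Qed.

End Main.

Theorem theorem3p3 (G : groupType) (X : Gtree G) :
  is_GBS X -> cocompact X ->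
  exists Y : Gtree G, [/\ is_GBS Y, fully_reduced Y & deformation X Y].
Proof.
by move=> XGBS /cocompact_orbits[n]; apply: bounded_reduces.
Qed.
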